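(* Let $Q\in\mathbb{R}^{n\times d}$ have orthonormal columns, with coherence $\mu(Q)=\max_{1\le i\le n}\|e_i^{\mathsf T}Q\|^2$. Let $\varepsilon,\delta\in(0,1)$, and choose an embedding dimension $k\ge d$ and a sparsity parameter $\zeta\in(0,k]$ with \[ k\ge\frac{16\,(d\vee 6\log(2d/\delta))}{\varepsilon^2}\qquad\text{and}\qquad\zeta\ge\frac{32\,\mu(Q)\log(2d/\delta)}{\varepsilon^2}. \] Let $\phi=\sqrt{k/\zeta}\,(\xi_1\psi_1,\dots,\xi_n\psi_n)^{\mathsf T}\in\mathbb{R}^n$ where $\xi_i\sim\textsc{bernoulli}(\zeta/k)$ iid and $\psi_i\sim\textsc{uniform}\{\pm1\}$ iid, all independent, and let $\Phi\in\mathbb{R}^{k\times n}$ be $k^{-1/2}$ times the matrix whose rows are $\phi_1^{\mathsf T},\dots,\phi_k^{\mathsf T}$, with $\phi_1,\dots,\phi_k$ iid copies of $\phi$. Then with probability at least $1-\delta$, \[ \|\Phi Qu\|^2\ge(1-\varepsilon)\|u\|^2\quad\text{for all }u\in\mathbb{R}^d, \] i.e., $\Phi$ is a $(1-\varepsilon)$-subspace injection for the range of $Q$.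
   Context: $e_1,\dots,e_n$ are the standard basis vectors of $\mathbb{R}^n$; $x\vee y=\max\{x,y\}$. For $\alpha>0$, a matrix $\Phi$ is an $\alpha$-subspace injection for the range of $Q$ if $\|\Phi Qu\|^2\ge\alpha\|u\|^2$ for all $u\in\mathbb{R}^d$. *)

(* Defs.v *)
From HB Require Import structures.
From mathcomp Require Import all_boot all_order all_algebra.
From mathcomp Require Import boolp reals exp.
Set Implicit Arguments. Unset Strict Implicit. Unset Printing Implicit Defensive.
Import Order.TTheory GRing.Theory Num.Theory.
Local Open Scope ring_scope.

Section Defs.
Variable R : realType.

Definition sqnorm (m : nat) (v : 'cV[R]_m) : R := \sum_(i < m) (v i 0) ^+ 2.

Definition coherence (n d : nat) (Q : 'M[R]_(n, d)) : R :=
  \big[Num.max/0]_(i < n) sqnorm (row i Q)^T.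

Definition subspace_injection (k n d : nat) (alpha : R)
  (Phi : 'M[R]_(k, n)) (Q : 'M[R]_(n, d)) : Prop :=
  forall u : 'cV[R]_d, sqnorm (Phi *m Q *m u) >= alpha * sqnorm u.

(* Sample space: for each row r < k and coordinate i < n, a pair
   (xi, psi) of bits: xi = Bernoulli(zeta/k) indicator, psi = sign
   (true = +1, false = -1).  All k*n*2 variables independent. *)
Definition outcome (k n : nat) := {ffun 'I_k * 'I_n -> bool * bool}.

Definition weight (k n : nat) (zeta : R) (w : outcome k n) : R :=
  let p := zeta / k%:R in
  \prod_(ri : 'I_k * 'I_n)
     ((if (w ri).1 then p else 1 - p) * 2^-1).

Definition Prob (k n : nat) (zeta : R) (E : outcome k n -> Prop) : R :=
  \sum_(w : outcome k n | `[< E w >]) weight zeta w.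

Definition sparse_embedding (k n : nat) (zeta : R) (w : outcome k n)
  : 'M[R]_(k, n) :=
  \matrix_(r < k, i < n)
    ((Num.sqrt k%:R)^-1 * (Num.sqrt (k%:R / zeta) *
      ((if (w (r, i)).1 then 1 else 0) * (if (w (r, i)).2 then 1 else -1)))).

End Defs.

(* Main.v *)
Require Import Defs.
From HB Require Import structures.
From mathcomp Require Import all_boot all_order all_algebra.
From mathcomp Require Import boolp reals exp.
From mathcomp Require Import classical_sets topology normedtype sequences derive realfun.
From mathcomp Require Import ring lra zify.
Set Implicit Arguments. Unset Strict Implicit. Unset Printing Implicit Defensive.
Import Order.TTheory GRing.Theory Num.Theory.
Import numFieldNormedType.Exports.
Local Open Scope ring_scope.

(** Put [S = (Phi Q)^T (Phi Q)].  By a Chernoff bound it suffices to control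
    [E tr exp (C - th S)], where [C] is a large multiple of the identity.
    The rows of [Phi Q] are exchanged one at a time (Lindeberg) for many tiny
    random-sign multiples of dense sign outer products.  For positive
    semidefinite [K] and [K - s x x^T], the third-order term of
    [tr (K - s x x^T)^j] in [s] has a favourable sign, so comparing the second
    order suffices, and this only involves the fourth moments of the entries:
    the coherence times [1 / zeta] enters through their kurtosis.  A step
    [- th z z^T] then costs a scalar factor [lam], with
    [k (lam - 1) = - th + th^2 (1/k + mu / (2 zeta))].

    The resulting dense random matrix has constant diagonal, and its
    off-diagonal quadratic form is bounded uniformly over the sphere by a
    PAC-Bayes argument: the Gibbs variational principle with a Gaussian-like
    prior on the integer lattice, the posterior being a randomised rounding of
    the test vector.  With [th = 6 L / eps], [L = ln (2 d / delta)], the total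
    exponent is at most [- L]. *)

(** Averaging over an independent increment is an operator on functions of the matrix, and such
    operators commute, so exchanging a row only needs a comparison at one deterministic matrix.
    There the mean [- (th / k)] of a row step is scalar, and all of its second-order effect except a
    convolution of traces, [trconv], is bounded by the trace itself; both go into [lam]. Sign steps
    are centred and reproduce [trconv], so [N] of them must satisfy
    [lam * N * s ^+ 2 = (th / k) ^+ 2].

    Inequalities are proved degree by degree for powers of positive semidefinite matrices. Hence the
    truncated series [trexp J], and a shift [C] whose positivity must survive every intermediate
    step; [J] tends to infinity only at the end.

    Diagonal and off-diagonal parts are separated by Young's inequality with conjugate exponents
    [p], [q]. The PAC-Bayes cost [Gam] has the order of [m = max (d, 6 L)], but the exponent can
    only afford a multiple of [L]: this dictates [p = m / (2 L)]. The lattice turns Gaussian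
    integrals into finite sums; the variance [v] added by rounding is compensated by the entropy
    [8 / 3 * v] of the rounding. *)

(** * Expectations under finite product measures *)

Section ProductExpectation.
Variables (R : realFieldType) (I T : finType).
Implicit Types (mu : I -> T -> R) (F G : {ffun I -> T} -> R).

Definition EE mu F : R := \sum_(w : {ffun I -> T}) (\prod_i mu i (w i)) * F w.

Lemma EE_prod mu (f : I -> T -> R) :
  EE mu (fun w => \prod_i f i (w i)) = \prod_i \sum_t mu i t * f i t.
Proof.
rewrite bigA_distr_bigA; apply: eq_bigr => w _.
by rewrite -big_split.
Qed.

Lemma eq_EE mu F G : F =1 G -> EE mu F = EE mu G.
Proof. by move=> e; apply: eq_bigr => w _; rewrite e. Qed.

Lemma EED mu F G : EE mu (fun w => F w + G w) = EE mu F + EE mu G.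
Proof. by rewrite -big_split; apply: eq_bigr => w _; rewrite mulrDr. Qed.

Lemma EEZ mu c F : EE mu (fun w => c * F w) = c * EE mu F.
Proof. by rewrite mulr_sumr; apply: eq_bigr => w _; rewrite mulrCA. Qed.

Lemma EEB mu F G : EE mu (fun w => F w - G w) = EE mu F - EE mu G.
Proof.
have -> : - EE mu G = -1 * EE mu G by rewrite mulN1r.
by rewrite -EEZ -EED; apply: eq_EE => w; rewrite mulN1r.
Qed.

Lemma EE_sum mu (J : Type) (s : seq J) (P : pred J) (F : J -> {ffun I -> T} -> R) :
  EE mu (fun w => \sum_(j <- s | P j) F j w) = \sum_(j <- s | P j) EE mu (F j).
Proof. by rewrite exchange_big; apply: eq_bigr => w _; rewrite mulr_sumr. Qed.

Lemma le_EE mu F G : (forall i t, 0 <= mu i t) ->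
  (forall w, F w <= G w) -> EE mu F <= EE mu G.
Proof.
move=> mu0 FG; apply: ler_sum => w _; apply: ler_wpM2l => //.
by apply: prodr_ge0.
Qed.

Variable mu : I -> T -> R.
Hypothesis mu1 : forall i, \sum_t mu i t = 1.

Lemma EE_cst c : EE mu (fun=> c) = c.
Proof.
transitivity (EE mu (fun w => c * \prod_i (fun _ _ => 1) i (w i))).
  by apply: eq_EE => w; rewrite big1 ?mulr1.
rewrite EEZ (EE_prod mu (fun _ _ => 1)) [X in _ * X]big1 ?mulr1 // => i _.
by rewrite -[RHS](mu1 i); apply: eq_bigr => t _; rewrite mulr1.
Qed.

Lemma EE_coord a (g : T -> R) : EE mu (fun w => g (w a)) = \sum_t mu a t * g t.
Proof.
transitivity (EE mu (fun w => \prod_i (fun i t => if i == a then g t else 1) i (w i))).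
  apply: eq_EE => w; rewrite (bigD1 a) //= eqxx big1 ?mulr1 // => i /negPf -> //.
rewrite (EE_prod mu (fun i t => if i == a then g t else 1)) (bigD1 a) //= eqxx [X in _ * X]big1 ?mulr1 // => i /negPf ->.
by rewrite -[RHS](mu1 i); apply: eq_bigr => t _; rewrite mulr1.
Qed.

Lemma EE_coord2 a b (g h : T -> R) : a != b ->
  EE mu (fun w => g (w a) * h (w b)) = (\sum_t mu a t * g t) * (\sum_t mu b t * h t).
Proof.
move=> ab.
have ba : (b == a) = false by rewrite eq_sym; exact: negPf.
transitivity (EE mu (fun w => \prod_i (fun i t =>
   if i == a then g t else if i == b then h t else 1) i (w i))).
  apply: eq_EE => w; rewrite (bigD1 a) //= eqxx; congr (_ * _).
  rewrite (bigD1 b) /=; last by rewrite ba.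
  by rewrite ba eqxx big1 ?mulr1 // => i /andP[/negPf -> /negPf ->].
rewrite (EE_prod mu (fun i t => if i == a then g t else if i == b then h t else 1)).
rewrite (bigD1 a) //= eqxx; congr (_ * _).
rewrite (bigD1 b) /=; last by rewrite ba.
rewrite ba eqxx [X in _ * X]big1 ?mulr1 // => i /andP[/negPf -> /negPf ->].
by rewrite -[RHS](mu1 i); apply: eq_bigr => t _; rewrite mulr1.
Qed.

End ProductExpectation.

(** * Moments of quadratic forms in iid variables with vanishing odd moments *)

Section FourthMoment.
Variables (R : realFieldType) (I T : finType) (nu g : T -> R) (m2 m4 : R).
Hypothesis nu1 : \sum_t nu t = 1.
Hypothesis nug1 : \sum_t nu t * g t = 0.
Hypothesis nug2 : \sum_t nu t * g t ^+ 2 = m2.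
Hypothesis nug3 : \sum_t nu t * g t ^+ 3 = 0.
Hypothesis nug4 : \sum_t nu t * g t ^+ 4 = m4.
Local Notation E := (EE (fun _ : I => nu)).

Lemma EE_second (a b : I) : E (fun w => g (w a) * g (w b)) = m2 * (a == b)%:R.
Proof.
have [<-|ab] := eqVneq a b; last by rewrite EE_coord2 // nug1 mul0r mulr0.
by rewrite (EE_coord (mu := fun=> nu) _ a (fun t => g t * g t)) // mulr1 -nug2.
Qed.

Let M n := \sum_t nu t * g t ^+ n.
Let M0 : M 0 = 1.
Proof. by rewrite -nu1; apply: eq_bigr => t _; rewrite mulr1. Qed.
Let M1 : M 1 = 0. Proof. exact: nug1. Qed.
Let M2 : M 2 = m2. Proof. exact: nug2. Qed.
Let M3 : M 3 = 0. Proof. exact: nug3. Qed.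
Let M4 : M 4 = m4. Proof. exact: nug4. Qed.

Let prodM (h : I -> R) (a : I) : \prod_i h i ^+ (i == a) = h a.
Proof. by rewrite (bigD1 a) //= eqxx big1 ?mulr1 // => i /negPf ->. Qed.

(** An index of odd multiplicity contributes a zero factor, so only the three pairings survive. When
    all four indices coincide the pairings count [3 * m2 ^+ 2], which the last term corrects to
    [m4]. *)
Lemma EE_fourth (a b c e : I) :
  E (fun w => (g (w a) * g (w b)) * (g (w c) * g (w e))) =
  m2 ^+ 2 * (((a == b) && (c == e))%:R + ((a == c) && (b == e))%:R
     + ((a == e) && (b == c))%:R)
  + (m4 - 3 * m2 ^+ 2) * [&& a == b, a == c & a == e]%:R.
Proof.
pose n i := ((i == a) + (i == b) + ((i == c) + (i == e)))%N.
transitivity (E (fun w => \prod_i (fun i t => g t ^+ n i) i (w i))).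
  apply: eq_EE => w /=; rewrite /n.
  under eq_bigr do rewrite !exprD.
  by rewrite !big_split /= !(prodM (fun i => g (w i))).
rewrite (EE_prod (fun=> nu) (fun i t => g t ^+ n i)).
rewrite (eq_bigr (fun i => M (n i))) //.
have z x : n x = 1%N \/ n x = 3%N -> \prod_i M (n i) = 0.
  by move=> H; rewrite (bigD1 x) //=; case: H => ->; rewrite ?M1 ?M3 mul0r.
have n0 i : i != a -> i != b -> i != c -> i != e -> n i = 0%N.
  by rewrite /n => /negPf -> /negPf -> /negPf -> /negPf ->.
rewrite /n in z n0 *.
have [ab|ab] := eqVneq a b.
  subst b; have [ce|ce] := eqVneq c e.
    subst e; have [ac|ac] := eqVneq a c.
      subst c; rewrite (bigD1 a) //= eqxx M4 big1 ?mulr1 => [|i ia]; last by rewrite n0.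
      by rewrite /=; ring.
    rewrite (bigD1 a) //= eqxx (negPf ac) M2 (bigD1 c) /=; last by rewrite eq_sym.
    rewrite eqxx eq_sym (negPf ac) M2 big1 => [|i /andP[ia ic]]; last by rewrite n0.
    by rewrite /=; ring.
  have [ac|ac] := eqVneq a c.
    subst c; rewrite (negPf ce) /= (z e); first by rewrite /= ?andbF /=; ring.
    by rewrite eqxx ![e == a]eq_sym (negPf ce); left.
  rewrite /= (z c) ?andbF; first by rewrite /=; ring.
  by rewrite eqxx ![c == a]eq_sym (negPf ac) (negPf ce); left.
have [ac|ac] := eqVneq a c.
  subst c; have [be|be] := eqVneq b e.
    subst e; rewrite (negPf ab) (bigD1 a) //= eqxx (negPf ab) M2 (bigD1 b) /=; last by rewrite eq_sym.
    rewrite eqxx eq_sym (negPf ab) M2 big1 => [|i /andP[ia ic]]; last by rewrite n0.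
    by rewrite /=; ring.
  rewrite (z b); first by rewrite [b == a]eq_sym (negPf ab) /= ?andbF /=; ring.
  by rewrite eqxx ![b == a]eq_sym (negPf ab) (negPf be); left.
have [bc|bc] := eqVneq b c.
  subst c; have [ae|ae] := eqVneq a e.
    subst e; rewrite (bigD1 a) //= eqxx (negPf ab) M2 (bigD1 b) /=; last by rewrite eq_sym.
    rewrite eqxx eq_sym (negPf ab) M2 big1 => [|i /andP[ia ic]]; last by rewrite n0.
    by rewrite /=; ring.
  rewrite (z a); first by rewrite /= ?andbF /=; ring.
  by rewrite eqxx (negPf ab) (negPf ae); left.
rewrite /= andbF.
have [ae|ae] := eqVneq a e.
  subst e; rewrite (z b); first by rewrite /= ?andbF /=; ring.
  by rewrite eqxx ![b == a]eq_sym (negPf ab) (negPf bc); left.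
rewrite (z a); first by rewrite /= ?andbF /=; ring.
by rewrite eqxx (negPf ab) (negPf ac) (negPf ae); left.
Qed.

Lemma EE_quad (B : I -> I -> R) :
  E (fun w => \sum_i \sum_j B i j * (g (w i) * g (w j))) = m2 * \sum_i B i i.
Proof.
rewrite EE_sum mulr_sumr; apply: eq_bigr => i _.
rewrite EE_sum (bigD1 i) //= EEZ EE_second eqxx big1 => [|j ji].
  by rewrite mulr1 addr0 mulrC.
by rewrite EEZ EE_second eq_sym (negPf ji) !mulr0.
Qed.

Let delta (F : I -> R) (i : I) : \sum_j (i == j)%:R * F j = F i.
Proof.
rewrite (bigD1 i) //= eqxx mul1r big1 ?addr0 // => j ji.
by rewrite eq_sym (negPf ji) mul0r.
Qed.

(** The three pairings are summed separately; symmetry of [C] merges the two crossed ones into the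
    factor 2. *)
Lemma EE_quad2 (B C : I -> I -> R) : (forall i j, C i j = C j i) ->
  E (fun w => (\sum_i \sum_j B i j * (g (w i) * g (w j))) *
              (\sum_i \sum_j C i j * (g (w i) * g (w j)))) =
  m2 ^+ 2 * ((\sum_i B i i) * (\sum_i C i i) + 2 * \sum_i \sum_j B i j * C i j)
  + (m4 - 3 * m2 ^+ 2) * \sum_i B i i * C i i.
Proof.
move=> Csym.
transitivity (\sum_a \sum_b \sum_c \sum_e (B a b * C c e) *
   E (fun w => (g (w a) * g (w b)) * (g (w c) * g (w e)))).
  rewrite (eq_EE _ (G := fun w => \sum_a \sum_b \sum_c \sum_e (B a b * C c e) *
     ((g (w a) * g (w b)) * (g (w c) * g (w e))))); last first.
    move=> w; rewrite mulr_suml; apply: eq_bigr => a _.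
    rewrite mulr_suml; apply: eq_bigr => b _; rewrite mulr_sumr; apply: eq_bigr => c _.
    by rewrite mulr_sumr; apply: eq_bigr => e _; rewrite mulrACA.
  rewrite EE_sum; apply: eq_bigr => a _; rewrite EE_sum; apply: eq_bigr => b _.
  rewrite EE_sum; apply: eq_bigr => c _; rewrite EE_sum; apply: eq_bigr => e _.
  by rewrite EEZ.
transitivity (\sum_a \sum_b (m2 ^+ 2 * ((a == b)%:R * (B a b * \sum_c C c c) + B a b * C a b + B a b * C b a)
   + (m4 - 3 * m2 ^+ 2) * ((a == b)%:R * (B a b * C a a)))).
  apply: eq_bigr => a _; apply: eq_bigr => b _.
  transitivity (\sum_c \sum_e (m2 ^+ 2 * ((a == b)%:R * B a b * ((c == e)%:R * C c e)
      + (a == c)%:R * ((b == e)%:R * (B a b * C c e)) + (b == c)%:R * ((a == e)%:R * (B a b * C c e)))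
      + (m4 - 3 * m2 ^+ 2) * ((a == b)%:R * ((a == c)%:R * ((a == e)%:R * (B a b * C c e)))))).
    apply: eq_bigr => c _; apply: eq_bigr => e _; rewrite EE_fourth -!mulnb !natrM; ring.
  transitivity (\sum_c (m2 ^+ 2 * ((a == b)%:R * B a b * C c c
      + (a == c)%:R * (B a b * C c b) + (b == c)%:R * (B a b * C c a))
      + (m4 - 3 * m2 ^+ 2) * ((a == b)%:R * ((a == c)%:R * (B a b * C c a))))).
    apply: eq_bigr => c _.
    by rewrite big_split -!mulr_sumr !big_split -!mulr_sumr /= !delta.
  rewrite big_split -!mulr_sumr !big_split -!mulr_sumr /=.
  by rewrite !delta; ring.
transitivity (\sum_a (m2 ^+ 2 * (B a a * \sum_c C c c + 2 * \sum_b B a b * C a b)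
   + (m4 - 3 * m2 ^+ 2) * (B a a * C a a))).
  apply: eq_bigr => a _; rewrite big_split -!mulr_sumr !big_split /= !delta.
  have -> : \sum_b B a b * C b a = \sum_b B a b * C a b.
    by apply: eq_bigr => b _; rewrite Csym.
  ring.
by rewrite big_split -!mulr_sumr !big_split /= -mulr_suml -!mulr_sumr.
Qed.

End FourthMoment.

(** * Noncommutative telescoping and log-convex sequences *)

Lemma subrXX_noncomm (A : pzRingType) (x y : A) n :
  x ^+ n - y ^+ n = \sum_(i < n) x ^+ i * (x - y) * y ^+ (n.-1 - i).
Proof.
elim: n => [|n IH]; first by rewrite big_ord0 subrr.
rewrite big_ord_recl expr0 mul1r subn0 /=.
have -> : x ^+ n.+1 - y ^+ n.+1 = (x - y) * y ^+ n + x * (x ^+ n - y ^+ n).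
  by rewrite !exprS mulrBl mulrBr [RHS]addrC addrA subrK.
rewrite IH mulr_sumr; congr (_ + _); apply: eq_bigr => i _.
by rewrite /bump /= add1n exprS !mulrA; congr (_ * _ ^+ _); lia.
Qed.

(** The ratios [a n.+1 / a n] are nondecreasing, so each of the [i] factors leading from [a 0] to
    [a i] is at most the matching factor from [a l] to [a (i + l)]. If [a 1] vanishes, so do all
    later terms. *)
Lemma logconvex_mul (R : realFieldType) (a : nat -> R) : (forall n, 0 <= a n) ->
  (forall n, a n.+1 ^+ 2 <= a n * a n.+2) ->
  forall i l, a i * a l <= a 0%N * a (i + l)%N.
Proof.
move=> a0 ac.
have [a1|] := boolP (a 1%N == 0).
  have az n : a n.+1 = 0.
    elim: n => [|n IH]; first exact/eqP.
    apply/eqP; rewrite -sqrf_eq0; apply/eqP/le_anti; rewrite sqr_ge0 andbT.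
    by have := ac n.+1; rewrite IH mul0r.
  by case=> [|i] l //; rewrite addSn !az mul0r mulr0.
move=> a1; have ap n : 0 < a n.+1.
  elim: n => [|n IH]; first by rewrite lt0r a1 a0.
  rewrite lt0r a0 andbT; apply: contraTneq (ac n) => e.
  by rewrite e mulr0 -ltNge exprn_gt0.
have a00 : 0 < a 0%N.
  rewrite lt0r a0 andbT; apply: contraTneq (ac 0%N) => e.
  by rewrite e mul0r -ltNge exprn_gt0.
have {}ap n : 0 < a n by case: n.
pose r n := a n.+1 / a n.
have rE n : a n.+1 = r n * a n by rewrite /r divfK // gt_eqF.
have rS n : r n <= r n.+1.
  by rewrite /r ler_pdivrMr // mulrAC ler_pdivlMr // -expr2 mulrC.
have rmono n m : r n <= r (n + m)%N.
  by elim: m => [|m IH]; rewrite ?addn0 // addnS; apply: le_trans IH (rS _).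
elim=> [|i IH] l //; rewrite addSn !rE -mulrA [leRHS]mulrCA.
by apply: ler_pM => //; [exact: divr_ge0 | exact: mulr_ge0].
Qed.

(** * Quadratic forms and positive semidefinite matrices *)

Section QuadraticForms.
Variables (R : realFieldType) (d : nat).
Local Notation M := 'M[R]_d.+1.
Local Notation V := 'cV[R]_d.+1.
Implicit Types (K A B : M) (u v x : V).

Definition bf K u v : R := (u^T *m K *m v) 0 0.
Definition qf K u : R := bf K u u.

Lemma bfE K u v : bf K u v = \sum_i \sum_j K i j * (u i 0 * v j 0).
Proof.
rewrite /bf !mxE exchange_big /=; apply: eq_bigr => j _.
rewrite !mxE mulr_suml; apply: eq_bigr => i _; rewrite !mxE; ring.
Qed.

Lemma bfDl K u u' v : bf K (u + u') v = bf K u v + bf K u' v.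
Proof. by rewrite /bf linearD /= !mulmxDl !mxE. Qed.
Lemma bfDr K u v v' : bf K u (v + v') = bf K u v + bf K u v'.
Proof. by rewrite /bf mulmxDr !mxE. Qed.
Lemma bfZl K c u v : bf K (c *: u) v = c * bf K u v.
Proof. by rewrite /bf linearZ /= -!scalemxAl !mxE. Qed.
Lemma bfZr K c u v : bf K u (c *: v) = c * bf K u v.
Proof. by rewrite /bf -!scalemxAr !mxE. Qed.
Lemma qfDm A B u : qf (A + B) u = qf A u + qf B u.
Proof. by rewrite /qf /bf mulmxDr mulmxDl !mxE. Qed.
Lemma qfZm c A u : qf (c *: A) u = c * qf A u.
Proof. by rewrite /qf /bf -scalemxAr -scalemxAl !mxE. Qed.
Lemma qfNm A u : qf (- A) u = - qf A u.
Proof. by rewrite -scaleN1r qfZm mulN1r. Qed.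
Lemma qfBm A B u : qf (A - B) u = qf A u - qf B u.
Proof. by rewrite qfDm qfNm. Qed.
Lemma qf0m u : qf 0 u = 0.
Proof. by rewrite -(scale0r 0) qfZm mul0r. Qed.
Lemma qf_sum (I : Type) (s : seq I) (P : pred I) (F : I -> M) u :
  qf (\sum_(i <- s | P i) F i) u = \sum_(i <- s | P i) qf (F i) u.
Proof. by elim/big_rec2: _ => [|i y1 y2 _ <-]; rewrite ?qf0m ?qfDm. Qed.

Lemma bfC K u v : K^T = K -> bf K u v = bf K v u.
Proof.
move=> Ks; rewrite !bfE exchange_big /=; apply: eq_bigr => i _; apply: eq_bigr => j _.
by rewrite -[in LHS]Ks mxE [u j 0 * _]mulrC.
Qed.

Lemma bf_mull K u v (A : M) : A^T = A -> bf K (A *m u) v = bf (A *m K) u v.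
Proof. by move=> As; rewrite /bf trmx_mul As !mulmxA. Qed.
Lemma bf_mulr K u v (A : M) : bf K u (A *m v) = bf (K *m A) u v.
Proof. by rewrite /bf !mulmxA. Qed.

Lemma qf1 u : qf 1 u = \sum_i u i 0 ^+ 2.
Proof. by rewrite /qf /bf mulmx1 mxE; apply: eq_bigr => i _; rewrite mxE expr2. Qed.

Lemma qf_scalar c u : qf c%:M u = c * \sum_i u i 0 ^+ 2.
Proof. by rewrite -qf1 -qfZm scalemx1. Qed.

Lemma qf_delta K a : qf K (delta_mx a 0) = K a a.
Proof.
rewrite /qf bfE (bigD1 a) //= (bigD1 a) //= !mxE !eqxx !mulr1.
rewrite !big1 ?addr0 // => i ia; rewrite ?big1 // => *; rewrite !mxE (negPf ia) ?mul0r ?mulr0 //.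
Qed.

Lemma qf_rank1_mul A B x : qf (A * (x *m x^T) * B) x = qf A x * qf B x.
Proof.
rewrite /qf /bf -!mulmxE !mulmxA.
have m11 (c N : 'M[R]_1) : (c *m N) 0 0 = c 0 0 * N 0 0 by rewrite mxE big_ord1.
by rewrite -!(mulmxA (x^T *m A *m x)) m11.
Qed.

Lemma tr_rank1_mul A B x : \tr (A * (x *m x^T) * B) = qf (B * A) x.
Proof.
rewrite /qf /bf -!mulmxE mxtrace_mulC !mulmxA mxtrace_mulC !mulmxA.
by rewrite /mxtrace big_ord1.
Qed.

Definition psd K := K^T = K /\ forall u, 0 <= qf K u.

Lemma psdD A B : psd A -> psd B -> psd (A + B).
Proof.
by case=> sA pA [sB pB]; split=> [|u]; rewrite ?linearD /= ?sA ?sB // qfDm addr_ge0.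
Qed.

Lemma psd_scalar c : 0 <= c -> psd c%:M.
Proof.
by move=> c0; split=> [|u]; rewrite ?tr_scalar_mx // qf_scalar mulr_ge0 // sumr_ge0 // => i _; rewrite sqr_ge0.
Qed.

Lemma bf_CS K u v : psd K -> bf K u v ^+ 2 <= qf K u * qf K v.
Proof.
case=> sK pK; set a := qf K v; set b := bf K u v; set c := qf K u.
have H s t : 0 <= s ^+ 2 * c + 2 * s * t * b + t ^+ 2 * a.
  have := pK (s *: u + t *: v); rewrite /qf !bfDl !bfDr !bfZl !bfZr (bfC v u sK).
  by rewrite -/(qf K u) -/(qf K v) -/a -/b -/c => h; apply: le_trans h _; rewrite le_eqVlt; apply/orP; left; apply/eqP; ring.
have a0 : 0 <= a by exact: pK.
have c0 : 0 <= c by exact: pK.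
have [az|an] := eqVneq a 0.
  (* When [a = 0] this choice leaves [- b ^+ 2 * (c + 2) >= 0], which forces [b = 0]. *)
  have := H b (- (c + 1)); rewrite az mulr0 addr0 mulr0.
  by have := sqr_ge0 b; nra.
have ap : 0 < a by rewrite lt0r an.
rewrite -(ler_pM2l ap) -subr_ge0; apply: le_trans (H a (- b)) _; rewrite le_eqVlt; apply/orP; left; apply/eqP; ring.
Qed.

Lemma trX_sym K n : K^T = K -> (K ^+ n)^T = K ^+ n.
Proof.
move=> sK; elim: n => [|n IH]; first by rewrite expr0 trmx1.
by rewrite {1}exprS -mulmxE trmx_mul IH sK mulmxE -exprSr.
Qed.

(** Writing [n = m + r + m] with [r] the parity and moving the outer powers onto [u] leaves [K ^+ r]
    at [K ^+ m *m u]; no square root or diagonalisation is involved. *)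
Lemma psdX K n : psd K -> psd (K ^+ n).
Proof.
move=> pK; have sK := pK.1; split; first exact: trX_sym.
move=> u; rewrite -(odd_double_half n) -addnn addnA [(odd n + _)%N]addnC -addnA.
rewrite exprD /qf -mulmxE -bf_mull; last exact: trX_sym.
rewrite exprD -mulmxE -bf_mulr.
case: (odd n); first by rewrite expr1; exact: pK.2.
by rewrite expr0 -/(qf _ _) qf1 sumr_ge0 // => i _; rewrite sqr_ge0.
Qed.

Lemma qfX_ge0 K n u : psd K -> 0 <= qf (K ^+ n) u.
Proof. by move=> /(psdX n) []. Qed.

(** Cauchy-Schwarz for [K ^+ n] at [u] and [K *m u]: the moments of [K] at [u] form a log-convex
    sequence. *)
Lemma qfX_CS K n u : psd K -> qf (K ^+ n.+1) u ^+ 2 <= qf (K ^+ n) u * qf (K ^+ n.+2) u.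
Proof.
move=> pK; have := bf_CS u (K *m u) (psdX n pK).
rewrite /qf !bf_mulr bf_mull ; last exact: pK.1.
by rewrite !mulmxE -exprSr -exprS.
Qed.

End QuadraticForms.

(** * Traces of powers and rank-one perturbations *)

Section PsdTraces.
Variables (R : realFieldType) (d : nat).
Local Notation M := 'M[R]_d.+1.
Local Notation V := 'cV[R]_d.+1.
Implicit Types (K A B : M) (u v x : V).

Lemma qfX_mul K i l u : psd K ->
  qf (K ^+ i) u * qf (K ^+ l) u <= qf 1 u * qf (K ^+ (i + l)) u.
Proof.
move=> pK; apply: (logconvex_mul (a := fun n => qf (K ^+ n) u)) => n.
  exact: qfX_ge0.
exact: qfX_CS.
Qed.

Lemma qf1_ge0 u : 0 <= qf 1 u.
Proof. by rewrite qf1 sumr_ge0 // => i _; rewrite sqr_ge0. Qed.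

Lemma psd_diag K a : psd K -> 0 <= K a a.
Proof. by case=> _ pK; rewrite -qf_delta. Qed.

Lemma psd_tr_ge0 K : psd K -> 0 <= \tr K.
Proof. by move=> pK; apply: sumr_ge0 => a _; exact: psd_diag. Qed.

(** The form is evaluated at [u b e_a - u a e_b] for every pair [a], [b]; the double sum of these
    nonnegative numbers is twice the deficit. *)
Lemma psd_qf_le_tr K u : psd K -> qf K u <= qf 1 u * \tr K.
Proof.
move=> pK; have sK := pK.1.
suff: 0 <= \sum_a \sum_b (u b 0 ^+ 2 * K a a + u a 0 ^+ 2 * K b b - 2 * (K a b * (u a 0 * u b 0))).
  have -> : \sum_a \sum_b (u b 0 ^+ 2 * K a a + u a 0 ^+ 2 * K b b - 2 * (K a b * (u a 0 * u b 0)))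
     = 2 * (qf 1 u * \tr K - qf K u).
    under eq_bigr do rewrite !big_split /= -mulr_suml -mulr_sumr sumrN -mulr_sumr -!qf1.
    rewrite !big_split /= -mulr_suml -mulr_sumr sumrN -mulr_sumr -!qf1.
    by rewrite /mxtrace [qf K u]bfE; ring.
  by move=> h; rewrite -subr_ge0 -(pmulr_rge0 _ (x := 2)) .
apply: sumr_ge0 => a _; apply: sumr_ge0 => b _.
have := pK.2 (u b 0 *: delta_mx a 0 - u a 0 *: delta_mx b 0).
rewrite -scaleNr /qf !bfDl !bfDr !bfZl !bfZr (bfC (delta_mx b 0) _ sK).
rewrite -!/(qf K _) !qf_delta.
have -> : bf K (delta_mx a 0) (delta_mx b 0) = K a b.
  rewrite bfE (bigD1 a) //= (bigD1 b) //= !mxE !eqxx !mulr1.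
  rewrite !big1 ?addr0 // => i ia; rewrite ?big1 // => *; rewrite !mxE (negPf ia) ?mul0r ?mulr0 //.
by move=> h; apply: le_trans h _; rewrite le_eqVlt; apply/orP; left; apply/eqP; ring.
Qed.

(** The order relation [K <= c] propagates to [K ^+ n.+1 <= c * K ^+ n]. For even [n] it is applied
    at [K ^+ n./2 *m u]; for odd [n], Cauchy-Schwarz reduces to the next even exponent, and
    [qf (K ^+ 2) w] cancels. *)
Lemma tr_powX_le K (c : R) j : 0 <= c -> psd K -> psd (c%:M - K) ->
  \tr (K ^+ j) <= d.+1%:R * c ^+ j.
Proof.
move=> c0 pK pc.
have step u n : qf (K ^+ n.+1) u <= c * qf (K ^+ n) u.
  have even w : qf K w <= c * qf 1 w.
    by have := pc.2 w; rewrite qfBm qf_scalar -qf1 subr_ge0.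
  have := odd_double_half n; case: (odd n) => /= <-.
    set m := n./2; rewrite -addnn.
    have E l : qf (K ^+ (m + l + m)) u = qf (K ^+ l) (K ^+ m *m u).
      rewrite /qf bf_mulr bf_mull; last by apply: trX_sym; exact: pK.1.
      by rewrite !mulmxE mulrA -!exprD.
    have -> : (1 + (m + m)).+1 = (m + 2 + m)%N by lia.
    have -> : (1 + (m + m))%N = (m + 1 + m)%N by lia.
    rewrite !E expr1; move: (K ^+ m *m u) => w.
    have h0 : 0 <= qf (K ^+ 2) w by exact: qfX_ge0.
    have h1 : 0 <= qf K w by exact: pK.2.
    have CS := qfX_CS 1 w pK; rewrite expr1 in CS.
    have h3 : qf (K ^+ 3) w <= c * qf (K ^+ 2) w.
      have := even (K *m w); rewrite /qf !bf_mulr !bf_mull ?(pK.1) // !mulmxE mul1r.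
      by rewrite mulrA !exprS expr0 mulr1 !mulrA.
    have [z|nz] := eqVneq (qf (K ^+ 2) w) 0; first by rewrite z mulr_ge0.
    have p2 : 0 < qf (K ^+ 2) w by rewrite lt0r nz.
    rewrite -(ler_pM2l p2) -expr2; apply: le_trans CS _.
    by apply: le_trans (ler_wpM2l h1 h3) _; rewrite le_eqVlt; apply/orP; left; apply/eqP; ring.
  set m := n./2; rewrite -addnn.
  have E l : qf (K ^+ (m + l + m)) u = qf (K ^+ l) (K ^+ m *m u).
    rewrite /qf bf_mulr bf_mull; last by apply: trX_sym; exact: pK.1.
    by rewrite !mulmxE mulrA -!exprD.
  have -> : (0 + (m + m)).+1 = (m + 1 + m)%N by lia.
  have -> : (0 + (m + m))%N = (m + 0 + m)%N by lia.
  by rewrite !E expr1 expr0; exact: even.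
have all u : qf (K ^+ j) u <= c ^+ j * qf 1 u.
  elim: j => [|j IH]; first by rewrite !expr0 mul1r.
  by apply: le_trans (step _ _) _; rewrite exprS -mulrA ler_wpM2l.
rewrite -[X in X%:R]card_ord mulrC -sumr_const mulr_sumr.
apply: ler_sum => a _; rewrite mulr1 -qf_delta; apply: le_trans (all _) _.
by rewrite qf_delta mxE eqxx mulr1.
Qed.

(** Power-mean inequality for the moments at [u], from log-convexity, followed by domination of the
    form by the trace. *)
Lemma tr_powX_ge K j u : psd K -> qf 1 u ^+ j * \tr (K ^+ j) >= qf K u ^+ j.
Proof.
move=> pK; case: j => [|j].
  by rewrite !expr0 mul1r mxtrace1 ler1n.
apply: le_trans (_ : qf 1 u ^+ j * qf (K ^+ j.+1) u <= _); last first.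
  rewrite [qf 1 u ^+ j.+1]exprSr -mulrA ler_wpM2l ?exprn_ge0 ?qf1_ge0 //.
  by apply: psd_qf_le_tr; exact: psdX.
elim: j => [|j IH]; first by rewrite !expr1 expr0 mul1r.
rewrite exprS; apply: le_trans (ler_wpM2l _ IH) _; first exact: pK.2.
rewrite mulrCA [qf 1 u ^+ j.+1]exprSr -mulrA ler_wpM2l ?exprn_ge0 ?qf1_ge0 //.
by have := qfX_mul 1 j.+1 u pK; rewrite expr1 add1n.
Qed.

(** Second-order coefficient of [\tr ((K - s x x^T) ^+ j)]: positions [i] and [i + e + 1] of the
    cyclic word carry [x x^T], leaving gaps of lengths [e] and [j - 2 - e]. Truncated subtraction is
    harmless, the inner range being empty for [j < 2]. *)
Definition conv2 (a b : nat -> R) j :=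
  \sum_(i < j) \sum_(e < j.-1 - i) a e * b (j.-2 - e)%N.

Lemma qfX_rank1 K x s a :
  qf (K ^+ a) x - qf ((K - s *: (x *m x^T)) ^+ a) x =
  s * \sum_(e < a) qf ((K - s *: (x *m x^T)) ^+ e) x * qf (K ^+ (a.-1 - e)) x.
Proof.
set B := K - _.
rewrite -qfBm -opprB subrXX_noncomm -sumrN qf_sum mulr_sumr; apply: eq_bigr => e _.
have -> : B - K = - (s *: (x *m x^T)) by rewrite /B addrC addrA addNr add0r.
rewrite mulrN mulNr opprK -scalerAr -scalerAl qfZm qf_rank1_mul //.
Qed.

(** An exact identity: telescoping is applied twice, and the powers of [B] rather than [K] in one
    gap absorb all higher orders in [s]. *)
Lemma trX_rank1 K x s j : let B := K - s *: (x *m x^T) in K^T = K ->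
  \tr (B ^+ j) = \tr (K ^+ j) - s * (j%:R * qf (K ^+ j.-1) x)
    + s ^+ 2 * conv2 (fun e => qf (B ^+ e) x) (fun e => qf (K ^+ e) x) j.
Proof.
move=> B sK.
have KB : K - B = s *: (x *m x^T) by rewrite /B opprB addrC subrK.
have : \tr (K ^+ j - B ^+ j) = s * (j%:R * qf (K ^+ j.-1) x)
    - s ^+ 2 * conv2 (fun e => qf (B ^+ e) x) (fun e => qf (K ^+ e) x) j.
  rewrite subrXX_noncomm raddf_sum /= /conv2 expr2 -mulrA -mulrBr mulr_sumr.
  rewrite -[j in j%:R * _]card_ord -sumr_const mulr_suml -sumrB mulr_sumr.
  apply: eq_bigr => i _.
  rewrite KB -scalerAr -scalerAl linearZ /= tr_rank1_mul; congr (_ * _).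
  rewrite mul1r.
  have ji : (i <= j.-1)%N by case: j i => [[]|j [i]] //=; rewrite ltnS.
  have -> : K ^+ j.-1 = K ^+ (j.-1 - i) * K ^+ i by rewrite -exprD subnK.
  apply/eqP; rewrite eq_sym subr_eq addrC -subr_eq -qfBm -mulrBl; apply/eqP.
  rewrite -[K ^+ _ - _]opprB subrXX_noncomm -sumrN mulr_suml qf_sum mulr_sumr.
  apply: eq_bigr => e _.
  rewrite -(opprB K B) KB mulrN !mulNr opprK -scalerAr -!scalerAl qfZm -mulrA qf_rank1_mul.
  rewrite -exprD; congr (_ * (_ * qf (K ^+ _) x)).
  by case: e => e /=; lia.
by rewrite raddfB /= => /eqP; rewrite subr_eq => /eqP ->; ring.
Qed.

Section TwoPsd.
Variables (K : M) (x : V) (s : R).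
Local Notation B := (K - s *: (x *m x^T)).
Hypotheses (s0 : 0 <= s) (pK : psd K) (pB : psd B).

Lemma qfX_rank1_le a : qf (B ^+ a) x <= qf (K ^+ a) x.
Proof.
rewrite -subr_ge0 qfX_rank1 mulr_ge0 // sumr_ge0 // => e _.
by rewrite mulr_ge0 ?qfX_ge0.
Qed.

Lemma trX_rank1_le j : \tr (B ^+ j) <= \tr (K ^+ j).
Proof.
rewrite -subr_ge0 -raddfB /= subrXX_noncomm raddf_sum /= sumr_ge0 // => i _.
rewrite subKr -scalerAr -scalerAl linearZ /= tr_rank1_mul.
rewrite mulr_ge0 //.
(* The mixed product is not symmetric, so its sign is not immediate. Expanding [K ^+ l] around
   [B ^+ l] leaves a pure power of [B] and products of forms in [B] alone and in [K] alone. *)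
suff H n l : 0 <= qf (B ^+ n * K ^+ l) x by exact: H.
move: l => {}i.
have -> : qf (B ^+ n * K ^+ i) x = qf (B ^+ n * B ^+ i) x
    + s * \sum_(e < i) qf (B ^+ (n + e)) x * qf (K ^+ (i.-1 - e)) x.
  apply/eqP; rewrite [X in _ == X]addrC -subr_eq -qfBm -mulrBr; apply/eqP.
  rewrite -[K ^+ _ - _]opprB subrXX_noncomm -sumrN mulr_sumr qf_sum mulr_sumr.
  apply: eq_bigr => e _.
  rewrite -(opprB K B) subKr.
  rewrite !(mulrN, mulNr) opprK -scalerAr -!scalerAl -scalerAr qfZm !mulrA -exprD.
  by rewrite qf_rank1_mul mulrA.
rewrite -exprD addr_ge0 ?qfX_ge0 // mulr_ge0 // sumr_ge0 // => e _.
by rewrite mulr_ge0 ?qfX_ge0.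
Qed.

(* Along a rank-one direction the third-order Taylor remainder is nonpositive:
   in the expansion of [\tr (B ^+ j)], powers of [B] and [K] occur only between
   copies of [x] and contribute nonnegative scalars. *)
Lemma trX_rank1_upper j : \tr (B ^+ j) <= \tr (K ^+ j) - s * (j%:R * qf (K ^+ j.-1) x)
    + s ^+ 2 * conv2 (fun e => qf (K ^+ e) x) (fun e => qf (K ^+ e) x) j.
Proof.
rewrite trX_rank1; last exact: pK.1.
rewrite lerD2l ler_wpM2l ?sqr_ge0 //; apply: ler_sum => i _; apply: ler_sum => e _.
by rewrite ler_wpM2r ?qfX_ge0 ?qfX_rank1_le.
Qed.

End TwoPsd.

Section Symmetrized.
Variables (K : M) (x : V) (s : R).
Local Notation X := (x *m x^T).
Hypotheses (s0 : 0 <= s) (pK : psd K) (pm : psd (K - s *: X)) (pp : psd (K + s *: X)).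

Let Kp : K = (K + s *: X) - s *: X. Proof. by rewrite addrK. Qed.

(** Midpoint convexity in [s]: adding the two expansions leaves the increments from [K - s X] to
    [K + s X], nonnegative by monotonicity, weighted by moments of [K]. *)
Let qf_avg a : qf (K ^+ a) x *+ 2 <= qf ((K + s *: X) ^+ a) x + qf ((K - s *: X) ^+ a) x.
Proof.
have h1 := qfX_rank1 K x s a; have h2 := qfX_rank1 K x (- s) a.
rewrite scaleNr opprK in h2.
have : 0 <= s * \sum_(e < a) (qf ((K + s *: X) ^+ e) x - qf ((K - s *: X) ^+ e) x) * qf (K ^+ (a.-1 - e)) x.
  rewrite mulr_ge0 // sumr_ge0 // => e _; rewrite mulr_ge0 ?qfX_ge0 // subr_ge0.
  apply: le_trans (_ : qf (K ^+ e) x <= _); first exact: qfX_rank1_le.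
  by rewrite [in leLHS]Kp; apply: qfX_rank1_le => //; rewrite -Kp.
under eq_bigr do rewrite mulrBl.
rewrite sumrB mulrBr -h1.
have -> : s * \sum_(e < a) qf ((K + s *: X) ^+ e) x * qf (K ^+ (a.-1 - e)) x
   = qf ((K + s *: X) ^+ a) x - qf (K ^+ a) x by rewrite mulNr in h2; lra.
lra.
Qed.

(** First-order terms cancel between the two signs, and [qf_avg] allows [K] to replace [K + s X] and
    [K - s X] in the second-order coefficient, from below. *)
Lemma trX_rank1_avg j :
  \tr (K ^+ j) + s ^+ 2 * conv2 (fun e => qf (K ^+ e) x) (fun e => qf (K ^+ e) x) j <=
  2^-1 * (\tr ((K + s *: X) ^+ j) + \tr ((K - s *: X) ^+ j)).
Proof.
have h1 := trX_rank1 x s j pK.1; have h2 := trX_rank1 x (- s) j pK.1.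
rewrite /= scaleNr opprK in h1 h2.
rewrite h1 h2 sqrrN.
have : 0 <= s ^+ 2 * (conv2 (fun e => qf ((K + s *: X) ^+ e) x) (fun e => qf (K ^+ e) x) j
  + conv2 (fun e => qf ((K - s *: X) ^+ e) x) (fun e => qf (K ^+ e) x) j
  - conv2 (fun e => qf (K ^+ e) x) (fun e => qf (K ^+ e) x) j *+ 2).
  rewrite mulr_ge0 ?sqr_ge0 // -big_split -sumrMnl -sumrB sumr_ge0 // => i _.
  rewrite -big_split -sumrMnl -sumrB sumr_ge0 // => e _.
by rewrite /= -mulrDl -mulrnAl -mulrBl mulr_ge0 ?qfX_ge0 // subr_ge0.
nra.
Qed.

Lemma trX_rank1_ge j : \tr ((K - s *: X) ^+ j) <= \tr ((K + s *: X) ^+ j).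
Proof.
apply: le_trans (_ : \tr (K ^+ j) <= _); first exact: trX_rank1_le.
by rewrite [in leLHS]Kp; apply: trX_rank1_le => //; rewrite -Kp.
Qed.

Lemma conv2_ge0 (a b : nat -> R) j : (forall e, 0 <= a e) -> (forall e, 0 <= b e) ->
  0 <= conv2 a b j.
Proof. by move=> a0 b0; apply: sumr_ge0 => i _; apply: sumr_ge0 => e _; rewrite mulr_ge0. Qed.

Lemma trX_avg_ge j : \tr (K ^+ j) *+ 2 <= \tr ((K + s *: X) ^+ j) + \tr ((K - s *: X) ^+ j).
Proof.
have := trX_rank1_avg j.
have : 0 <= s ^+ 2 * conv2 (fun e => qf (K ^+ e) x) (fun e => qf (K ^+ e) x) j.
  by rewrite mulr_ge0 ?sqr_ge0 // conv2_ge0 // => e; exact: qfX_ge0.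
lra.
Qed.

(** Chebyshev's association inequality: both traces increase from [K - s X] to [K + s X], so the
    mean of the products is at least the product of the means, and each mean is at least its value
    at [K]. *)
Lemma tr_mul_avg i l : \tr (K ^+ i) * \tr (K ^+ l) <=
  2^-1 * (\tr ((K + s *: X) ^+ i) * \tr ((K + s *: X) ^+ l)
        + \tr ((K - s *: X) ^+ i) * \tr ((K - s *: X) ^+ l)).
Proof.
have gi := trX_rank1_ge i; have gl := trX_rank1_ge l.
have ai := trX_avg_ge i; have al := trX_avg_ge l.
have ti : 0 <= \tr (K ^+ i) by apply: psd_tr_ge0; exact: psdX.
have tl : 0 <= \tr (K ^+ l) by apply: psd_tr_ge0; exact: psdX.
move: gi gl ai al ti tl.
move: (\tr (K ^+ i)) (\tr (K ^+ l)) (\tr ((K + s *: X) ^+ i)) (\tr ((K + s *: X) ^+ l))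
  (\tr ((K - s *: X) ^+ i)) (\tr ((K - s *: X) ^+ l)) => A C A1 C1 A2 C2 gi gl ai al ti tl.
have : 0 <= (A1 - A2) * (C1 - C2) by rewrite mulr_ge0 ?subr_ge0.
have : (A *+ 2) * (C *+ 2) <= (A1 + A2) * (C1 + C2) by rewrite ler_pM ?mulrn_wge0.
have -> : (A *+ 2) * (C *+ 2) = 4 * (A * C) by ring.
have -> : A1 * C1 + A2 * C2 = 2^-1 * ((A1 + A2) * (C1 + C2) + (A1 - A2) * (C1 - C2)) by field.
lra.
Qed.

End Symmetrized.

(** [conv2] with traces in place of forms at [x]: the part of the second-order effect that sparse
    rows and sign steps have in common. *)
Definition trconv K j := conv2 (fun e => \tr (K ^+ e)) (fun e => \tr (K ^+ e)) j.

End PsdTraces.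

(** * Moments of powers of a matrix at a random vector *)

Section RandomVector.
Variables (R : realFieldType) (n d : nat) (T : finType) (nu g : T -> R) (m2 m4 : R).
Hypothesis nu0 : forall t, 0 <= nu t.
Hypothesis nu1 : \sum_t nu t = 1.
Hypothesis nug1 : \sum_t nu t * g t = 0.
Hypothesis nug2 : \sum_t nu t * g t ^+ 2 = m2.
Hypothesis nug3 : \sum_t nu t * g t ^+ 3 = 0.
Hypothesis nug4 : \sum_t nu t * g t ^+ 4 = m4.
Variable Q : 'M[R]_(n, d.+1).
Hypothesis QQ : Q^T *m Q = 1%:M.
Local Notation E := (EE (fun _ : 'I_n => nu)).
Local Notation M := 'M[R]_d.+1.

(** A transposed row of [Phi Q] when [g] gives the entries of [Phi]; with [Q] the identity it also
    covers sign vectors. *)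
Definition rvec (w : {ffun 'I_n -> T}) : 'cV[R]_d.+1 := Q^T *m (\col_i g (w i)).

Lemma qf_rvec (B : M) w :
  qf B (rvec w) = \sum_i \sum_j (Q *m B *m Q^T) i j * (g (w i) * g (w j)).
Proof.
transitivity (((\col_i g (w i))^T *m (Q *m B *m Q^T) *m (\col_i g (w i))) 0 0).
  by rewrite /qf /bf /rvec trmx_mul trmxK !mulmxA.
move: (Q *m B *m Q^T) => N.
rewrite mxE exchange_big /=; apply: eq_bigr => j _.
rewrite [(_ *m N) 0 j]mxE mulr_suml; apply: eq_bigr => i _; rewrite !mxE; ring.
Qed.

Lemma tr_conjQ (B : M) : \tr (Q *m B *m Q^T) = \tr B.
Proof. by rewrite mxtrace_mulC mulmxA QQ mul1mx. Qed.

Lemma conjQ_diag (B : M) i : (Q *m B *m Q^T) i i = qf B (row i Q)^T.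
Proof.
rewrite /qf /bf trmxK -row_mul [LHS]mxE [RHS]mxE; apply: eq_bigr => j _.
by rewrite [row i (Q *m B) 0 j]mxE ![_^T _ _]mxE [row i Q 0 j]mxE.
Qed.

Lemma EE_qf_rvec (B : M) : E (fun w => qf B (rvec w)) = m2 * \tr B.
Proof.
rewrite (eq_EE _ (qf_rvec B)) (EE_quad nu1 nug1 nug2) -(tr_conjQ B); by [].
Qed.

Lemma EE_qf2_rvec (B C : M) : C^T = C ->
  E (fun w => qf B (rvec w) * qf C (rvec w)) =
  m2 ^+ 2 * (\tr B * \tr C + 2 * \tr (B * C))
  + (m4 - 3 * m2 ^+ 2) * \sum_i qf B (row i Q)^T * qf C (row i Q)^T.
Proof.
move=> sC; pose B' := Q *m B *m Q^T; pose C' := Q *m C *m Q^T.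
have sC' i j : C' i j = C' j i.
  by rewrite -[in LHS](_ : C'^T = C') ?mxE // /C' !trmx_mul trmxK sC mulmxA.
rewrite (eq_EE _ (G := fun w => (\sum_i \sum_j B' i j * (g (w i) * g (w j))) *
    (\sum_i \sum_j C' i j * (g (w i) * g (w j))))); last by move=> w; rewrite !qf_rvec.
rewrite (EE_quad2 nu1 nug1 nug2 nug3 nug4) // -!/(\tr _) -(tr_conjQ B) -(tr_conjQ C) -/B' -/C'.
congr (_ * (_ + 2 * _) + _ * _).
  have -> : \tr (B * C) = \tr (B' *m C').
    by rewrite -(tr_conjQ (B * C)) -mulmxE /B' /C' !mulmxA -(mulmxA (Q *m B) Q^T Q) QQ mulmx1.
  apply: eq_bigr => i _; rewrite mxE; apply: eq_bigr => j _; by rewrite sC'.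
by apply: eq_bigr => i _; rewrite -!conjQ_diag.
Qed.

Lemma sum_qf_row (B : M) : \sum_i qf B (row i Q)^T = \tr B.
Proof. by rewrite -(tr_conjQ B); apply: eq_bigr => i _; rewrite conjQ_diag. Qed.

(** This is where coherence enters. At each row of [Q], log-convexity bounds the product of two
    moments by [mu] times the moment of order [i + l], and the rows add up to a trace. The negative
    part of the kurtosis coefficient is discarded. *)
Lemma EE_qfX_le (K : M) (mu : R) i l : psd K -> 0 <= m4 ->
  (forall r, qf 1 (row r Q)^T <= mu) ->
  E (fun w => qf (K ^+ i) (rvec w) * qf (K ^+ l) (rvec w)) <=
  m2 ^+ 2 * (\tr (K ^+ i) * \tr (K ^+ l)) + (2 * m2 ^+ 2 + m4 * mu) * \tr (K ^+ (i + l)).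
Proof.
move=> pK m40 qmu.
rewrite EE_qf2_rvec; last by apply: trX_sym; exact: pK.1.
rewrite -exprD.
have S1 : \sum_r qf (K ^+ i) (row r Q)^T * qf (K ^+ l) (row r Q)^T <= mu * \tr (K ^+ (i + l)).
  rewrite -sum_qf_row mulr_sumr; apply: ler_sum => r _.
  apply: le_trans (qfX_mul i l _ pK) _.
  by rewrite ler_wpM2r ?qfX_ge0.
have S0 : 0 <= \sum_r qf (K ^+ i) (row r Q)^T * qf (K ^+ l) (row r Q)^T.
  by apply: sumr_ge0 => r _; rewrite mulr_ge0 ?qfX_ge0.
have := sqr_ge0 m2.
nra.
Qed.

(** The kurtosis coefficient is [1 - 3 = - 2]; with row norms at most 1 its contribution is absorbed
    by the crossed pairings [2 * \tr (K ^+ (i + l))]. *)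
Lemma EE_qfX_ge (K : M) i l : psd K -> m2 = 1 -> m4 = 1 ->
  (forall r, qf 1 (row r Q)^T <= 1) ->
  \tr (K ^+ i) * \tr (K ^+ l) <=
  E (fun w => qf (K ^+ i) (rvec w) * qf (K ^+ l) (rvec w)).
Proof.
move=> pK h2 h4 qmu.
rewrite EE_qf2_rvec; last by apply: trX_sym; exact: pK.1.
rewrite -exprD h2 h4.
have S1 : \sum_r qf (K ^+ i) (row r Q)^T * qf (K ^+ l) (row r Q)^T <= \tr (K ^+ (i + l)).
  rewrite -sum_qf_row; apply: ler_sum => r _.
  apply: le_trans (qfX_mul i l _ pK) _.
  by rewrite -[leRHS]mul1r ler_wpM2r ?qfX_ge0.
lra.
Qed.

Lemma EE_conv2_le (K : M) (mu : R) j : psd K -> 0 <= m4 ->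
  (forall r, qf 1 (row r Q)^T <= mu) ->
  E (fun w => conv2 (fun e => qf (K ^+ e) (rvec w)) (fun e => qf (K ^+ e) (rvec w)) j) <=
  m2 ^+ 2 * trconv K j + (2 * m2 ^+ 2 + m4 * mu) * ('C(j, 2)%:R * \tr (K ^+ j.-2)).
Proof.
move=> pK m40 qmu; rewrite /conv2 EE_sum /trconv /conv2.
have -> : 'C(j, 2)%:R * \tr (K ^+ j.-2) = \sum_(i < j) \sum_(e < j.-1 - i) \tr (K ^+ j.-2).
  under eq_bigr do rewrite sumr_const card_ord -mulr_natl.
  rewrite -mulr_suml -natr_sum; congr (_%:R * _).
  rewrite -bin2_sum big_mkord (reindex_inj rev_ord_inj) /=.
  by apply: eq_bigr => i _; lia.
rewrite !mulr_sumr -big_split; apply: ler_sum => i _ /=.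
rewrite EE_sum !mulr_sumr -big_split; apply: ler_sum => e _ /=.
apply: le_trans (EE_qfX_le _ _ pK m40 qmu) _.
have ej : (e <= j.-2)%N by rewrite -ltnS; apply: leq_trans (leq_trans (ltn_ord e) (leq_subr i _)) (leqSpred _).
by rewrite subnKC // -mulr_sumr.
Qed.

Lemma EE_conv2_ge (K : M) j : psd K -> m2 = 1 -> m4 = 1 ->
  (forall r, qf 1 (row r Q)^T <= 1) ->
  trconv K j <=
  E (fun w => conv2 (fun e => qf (K ^+ e) (rvec w)) (fun e => qf (K ^+ e) (rvec w)) j).
Proof.
move=> pK h2 h4 qmu; rewrite /conv2 EE_sum /trconv /conv2.
apply: ler_sum => i _; rewrite EE_sum; apply: ler_sum => e _.
exact: EE_qfX_ge.
Qed.

End RandomVector.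

(** * Truncated trace exponentials *)

Section TruncatedExponential.
Variables (R : realFieldType) (d : nat).
Local Notation M := 'M[R]_d.+1.
Implicit Types (K : M) (x : 'cV[R]_d.+1).

Definition trexp J K : R := \sum_(j < J.+1) \tr (K ^+ j) / j`!%:R.
Definition convexp J K : R := \sum_(j < J.+1) trconv K j / j`!%:R.

(** Differentiating the truncated exponential series returns it without its top term. This missing
    term is the source of the truncation error. *)
Lemma sum_fact1 (a : nat -> R) J :
  \sum_(j < J.+1) (j%:R * a j.-1) / j`!%:R = \sum_(j < J.+1) a j / j`!%:R - a J / J`!%:R.
Proof.
rewrite big_ord_recl !mul0r add0r [in RHS]big_ord_recr /= addrK.
apply: eq_bigr => j _; rewrite /bump /= add1n factS natrM mulrC.
by rewrite invfM mulrACA mulVf ?pnatr_eq0 // mul1r mulrC.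
Qed.

Lemma sum_fact2 (a : nat -> R) J : (forall j, 0 <= a j) ->
  \sum_(j < J.+1) ('C(j, 2)%:R * a j.-2) / j`!%:R <= 2^-1 * \sum_(j < J.+1) a j / j`!%:R.
Proof.
move=> a0; case: J => [|J].
  by rewrite !big_ord1 /= bin0n /= !mul0r mulr_ge0 ?invr_ge0 ?divr_ge0.
rewrite !big_ord_recl /= /bump /= !bin0n bin_small // !mul0r !add0r.
have ge0 j : 0 <= a j / j`!%:R by rewrite divr_ge0.
apply: le_trans (_ : \sum_(j < J) 2^-1 * (a j / j`!%:R) <= _).
  apply: ler_sum => j _; rewrite !add1n /=.
  have -> : 'C(j.+2, 2)%:R = (j.+2%:R * j.+1%:R) / 2 :> R.
    have h := bin_ffact j.+2 2; rewrite !ffactnS ffactn0 muln1 /= in h.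
    by rewrite -natrM -h natrM mulfK ?pnatr_eq0.
  rewrite !factS !natrM !invfM.
  rewrite le_eqVlt; apply/orP; left; apply/eqP; field.
  by rewrite pnatr_eq0 -lt0n fact_gt0 /=; apply/andP; split; apply: lt0r_neq0; rewrite ltr_wpDr.
rewrite -mulr_sumr ler_wpM2l ?invr_ge0 //.
have : \sum_(j < J) a j / j`!%:R <= \sum_(j < J.+2) a j / j`!%:R.
  by rewrite !big_ord_recr /= -addrA lerDl addr_ge0.
by rewrite !big_ord_recl.
Qed.

Lemma trexp_ge0 J K : psd K -> 0 <= trexp J K.
Proof.
by move=> pK; apply: sumr_ge0 => j _; rewrite divr_ge0 // psd_tr_ge0 //; exact: psdX.
Qed.

End TruncatedExponential.

(** * Effect of one random step on the truncated trace exponential *)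

Section OneStep.
Variables (R : realFieldType) (n d : nat) (T : finType) (nu g : T -> R) (m2 m4 : R).
Hypothesis nu0 : forall t, 0 <= nu t.
Hypothesis nu1 : \sum_t nu t = 1.
Hypothesis nug1 : \sum_t nu t * g t = 0.
Hypothesis nug2 : \sum_t nu t * g t ^+ 2 = m2.
Hypothesis nug3 : \sum_t nu t * g t ^+ 3 = 0.
Hypothesis nug4 : \sum_t nu t * g t ^+ 4 = m4.
Variable Q : 'M[R]_(n, d.+1).
Hypothesis QQ : Q^T *m Q = 1%:M.
Local Notation E := (EE (fun _ : 'I_n => nu)).
Local Notation M := 'M[R]_d.+1.
Local Notation z := (rvec g Q).

(** Only the convolution of traces is not bounded by a multiple of [trexp]; it is kept as [convexp],
    to be matched by the sign steps. The last term comes from truncation. *)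
Lemma EE_trexp_upper (K : M) (mu s : R) J : psd K -> 0 <= m4 -> 0 <= mu -> 0 <= s ->
  (forall w, psd (K - s *: (z w *m (z w)^T))) ->
  (forall r, qf 1 (row r Q)^T <= mu) ->
  E (fun w => trexp J (K - s *: (z w *m (z w)^T))) <=
  (1 - s * m2 + s ^+ 2 * (m2 ^+ 2 + m4 * mu / 2)) * trexp J K
  + (s * m2) ^+ 2 * convexp J K + s * m2 * (\tr (K ^+ J) / J`!%:R).
Proof.
move=> pK m40 mu0 s0 pB qmu; rewrite /trexp EE_sum.
have m20 : 0 <= m2 by rewrite -nug2; apply: sumr_ge0 => t _; rewrite mulr_ge0 ?sqr_ge0.
have {}mu0 : 0 <= m4 * mu by rewrite mulr_ge0.
apply: le_trans (_ : \sum_(j < J.+1) (\tr (K ^+ j) / j`!%:R - s * m2 * ((j%:R * \tr (K ^+ j.-1)) / j`!%:R)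
    + (s * m2) ^+ 2 * (trconv K j / j`!%:R)
    + s ^+ 2 * (2 * m2 ^+ 2 + m4 * mu) * (('C(j, 2)%:R * \tr (K ^+ j.-2)) / j`!%:R)) <= _).
  apply: ler_sum => j _.
  apply: le_trans (_ : (\tr (K ^+ j) - s * (j%:R * (m2 * \tr (K ^+ j.-1))) +
     s ^+ 2 * (m2 ^+ 2 * trconv K j + (2 * m2 ^+ 2 + m4 * mu) * ('C(j, 2)%:R * \tr (K ^+ j.-2)))) / j`!%:R <= _).
    rewrite mulrC -[leLHS](eq_EE _ (F := fun w => j`!%:R^-1 * \tr ((K - s *: (z w *m (z w)^T)) ^+ j))); last by move=> w; rewrite mulrC.
    rewrite EEZ ler_wpM2l ?invr_ge0 //.
    apply: le_trans (le_EE _ (fun w => trX_rank1_upper s0 pK (pB w) j)) _ => //.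
    rewrite EED EEB EE_cst // !EEZ (EE_qf_rvec nu1 nug1 nug2 QQ) lerD2l ler_wpM2l ?sqr_ge0 //.
    exact: (EE_conv2_le nu1 nug1 nug2 nug3 nug4 QQ).
  by rewrite le_eqVlt; apply/orP; left; apply/eqP; ring.
rewrite !big_split /= sumrN -!mulr_sumr (sum_fact1 (fun j => \tr (K ^+ j))).
have := sum_fact2 J (a := fun j => \tr (K ^+ j)) (fun j => psd_tr_ge0 (psdX j pK)).
rewrite -/(trexp J K) -/(convexp J K).
have := trexp_ge0 J pK.
set S := \sum_(j < J.+1) _; move: (trexp J K) => A A0 hS.
have : s ^+ 2 * (2 * m2 ^+ 2 + m4 * mu) * S <= s ^+ 2 * (2 * m2 ^+ 2 + m4 * mu) * (2^-1 * A).
  by rewrite ler_wpM2l // mulr_ge0 ?sqr_ge0 // addr_ge0 // mulr_ge0 ?sqr_ge0.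
lra.
Qed.

Lemma EE_trexp_lower (K : M) (s : R) J : psd K -> 0 <= s -> m2 = 1 -> m4 = 1 ->
  (forall w, psd (K - s *: (z w *m (z w)^T))) ->
  (forall w, psd (K + s *: (z w *m (z w)^T))) ->
  (forall r, qf 1 (row r Q)^T <= 1) ->
  trexp J K + s ^+ 2 * convexp J K <=
  E (fun w => 2^-1 * (trexp J (K + s *: (z w *m (z w)^T)) + trexp J (K - s *: (z w *m (z w)^T)))).
Proof.
move=> pK s0 h2 h4 pm pp qmu.
rewrite (eq_EE _ (G := fun w => \sum_(j < J.+1) j`!%:R^-1 * (2^-1 * (\tr ((K + s *: (z w *m (z w)^T)) ^+ j)
   + \tr ((K - s *: (z w *m (z w)^T)) ^+ j))))); last first.
  move=> w; rewrite /trexp -big_split mulr_sumr; apply: eq_bigr => j _ /=; ring.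
rewrite EE_sum /trexp /convexp mulr_sumr -big_split; apply: ler_sum => j _ /=.
rewrite EEZ mulrC [_ * (_ / _)]mulrA [_ * j`!%:R^-1]mulrC -mulrDr ler_wpM2l ?invr_ge0 //.
apply: le_trans (le_EE _ (fun w => trX_rank1_avg s0 pK (pm w) (pp w) j)) => //.
rewrite EED EE_cst // EEZ lerD2l ler_wpM2l ?sqr_ge0 //.
exact: (EE_conv2_ge nu1 nug1 nug2 nug3 nug4 QQ).
Qed.

(** After several sign steps the second-order gain is evaluated at a displaced matrix; this bounds
    its mean below by the value at the starting point. *)
Lemma EE_convexp_lower (K : M) (s : R) J : psd K -> 0 <= s ->
  (forall w, psd (K - s *: (z w *m (z w)^T))) ->
  (forall w, psd (K + s *: (z w *m (z w)^T))) ->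
  convexp J K <=
  E (fun w => 2^-1 * (convexp J (K + s *: (z w *m (z w)^T)) + convexp J (K - s *: (z w *m (z w)^T)))).
Proof.
move=> pK s0 pm pp.
rewrite -[leLHS](EE_cst (mu := fun _ : 'I_n => nu)) //; apply: le_EE => // w.
rewrite /convexp -big_split mulr_sumr; apply: ler_sum => j _ /=.
rewrite -mulrDl mulrA ler_wpM2r ?invr_ge0 //.
rewrite /trconv /conv2 -big_split mulr_sumr; apply: ler_sum => i _ /=.
rewrite -big_split mulr_sumr; apply: ler_sum => e _ /=.
exact: tr_mul_avg.
Qed.

End OneStep.

(** * Averaging operators and the replacement argument *)

Section AveragingOperators.
Variables (R : realFieldType) (V : zmodType).
Implicit Types (f g : V -> R) (K : V).

Definition avg (A : finType) (p : A -> R) (X : A -> V) f K : R :=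
  \sum_a p a * f (K + X a).

Section One.
Variables (A : finType) (p : A -> R) (X : A -> V).
Hypotheses (p0 : forall a, 0 <= p a) (p1 : \sum_a p a = 1).
Local Notation T := (avg p X).

Lemma eq_iter_avg m f g : f =1 g -> iter m T f =1 iter m T g.
Proof.
by elim: m => //= m IH fg K; apply: eq_bigr => a _; rewrite IH.
Qed.

Lemma iter_avg_affine m c e f K :
  iter m T (fun K => c * f K + e) K = c * iter m T f K + e.
Proof.
elim: m K => //= m IH K; rewrite /avg.
under eq_bigr do rewrite IH mulrDr.
rewrite big_split -mulr_suml p1 mul1r /= mulr_sumr; congr (_ + _).
by apply: eq_bigr => a _; rewrite mulrCA.
Qed.

Lemma iter_avgD m f g K :
  iter m T (fun K => f K + g K) K = iter m T f K + iter m T g K.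
Proof.
elim: m K => //= m IH K; rewrite /avg.
by under eq_bigr do rewrite IH mulrDr; rewrite big_split.
Qed.

Lemma iter_avg_sum m (J : finType) (F : J -> V -> R) K :
  iter m T (fun K => \sum_j F j K) K = \sum_j iter m T (F j) K.
Proof.
elim: m K => //= m IH K; rewrite /avg exchange_big; apply: eq_bigr => a _ /=.
by rewrite IH mulr_sumr.
Qed.

Variable D : nat -> V -> Prop.
Hypothesis DT : forall m K a, D m.+1 K -> D m (K + X a).

(** [D m K] expresses that [m] further steps from [K] remain in the region where the inequality is
    known; each step spends one unit, and [r] units are left at the end. *)
Lemma iter_avg_le m r f g K : (forall K, D r K -> f K <= g K) ->
  D (m + r) K -> iter m T f K <= iter m T g K.
Proof.
move=> fg; elim: m K => [|m IH] K DK /=; first exact: fg.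
by apply: ler_sum => a _; rewrite ler_wpM2l // IH //; apply: DT.
Qed.

End One.

Lemma avgC (A B : finType) (p : A -> R) (q : B -> R) X Y f :
  avg p X (avg q Y f) =1 avg q Y (avg p X f).
Proof.
move=> K; rewrite /avg; under eq_bigr do rewrite mulr_sumr.
rewrite exchange_big; apply: eq_bigr => b _; rewrite mulr_sumr; apply: eq_bigr => a _.
by rewrite mulrCA addrAC.
Qed.

Lemma avg_iterC (A B : finType) (p : A -> R) (q : B -> R) X Y m f :
  avg p X (iter m (avg q Y) f) =1 iter m (avg q Y) (avg p X f).
Proof.
elim: m => //= m IH K; rewrite avgC.
by apply: eq_bigr => b _; rewrite IH.
Qed.

(* Lindeberg replacement: the two averaging operators commute, so the [k]
   steps of one can be exchanged for steps of the other one at a time. *)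
Lemma iter_avg_compare (A B : finType) (p : A -> R) (q : B -> R) X Y
  (D : nat -> V -> Prop) (N : nat) (f : V -> R) (lam e : R) :
  (forall a, 0 <= p a) -> \sum_a p a = 1 ->
  (forall b, 0 <= q b) -> \sum_b q b = 1 ->
  (forall m K a, D (N + m)%N K -> D m (K + X a)) ->
  (forall m K b, D m.+1 K -> D m (K + Y b)) ->
  0 <= lam <= 1 -> 0 <= e ->
  (forall K, D N K -> avg p X f K <= lam * iter N (avg q Y) f K + e) ->
  forall k K, D (k * N)%N K ->
  iter k (avg p X) f K <= lam ^+ k * iter (k * N) (avg q Y) f K + k%:R * e.
Proof.
move=> p0 p1 q0 q1 DX DY /andP[l0 l1] e0 step; elim=> [|k IH] K DK.
  by rewrite /= mul1r mul0r addr0.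
rewrite iterS.
apply: le_trans (_ : avg p X (fun K => lam ^+ k * iter (k * N) (avg q Y) f K + k%:R * e) K <= _).
  by apply: ler_sum => a _; rewrite ler_wpM2l // IH //; apply: DX; rewrite -mulSn.
(* The outstanding [X] step is commuted inside all [Y] steps, where the one-step hypothesis applies
   to [f] itself. *)
rewrite -[avg p X _ K]/(iter 1 (avg p X) _ K) iter_avg_affine //= avg_iterC.
apply: le_trans (_ : lam ^+ k * iter (k * N) (avg q Y) (fun K => lam * iter N (avg q Y) f K + e) K + k%:R * e <= _).
  rewrite lerD2r ler_wpM2l ?exprn_ge0 //; apply: (iter_avg_le q0 DY (r := N)).
    exact: step.
  by rewrite addnC -mulSn.
rewrite iter_avg_affine // mulrDr mulrA -exprSr -iterD addnC -mulSn -addrA lerD2l.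
rewrite -natr1 mulrDl mul1r addrC lerD2l.
by rewrite -[leRHS]mul1r ler_wpM2r // exprn_ile1.
Qed.

Definition ffcons (A : Type) k (x : A * {ffun 'I_k -> A}) : {ffun 'I_k.+1 -> A} :=
  [ffun i => if unlift ord0 i is Some j then x.2 j else x.1].

Lemma ffcons_bij (A : finType) k : bijective (@ffcons A k).
Proof.
exists (fun h : {ffun 'I_k.+1 -> A} => (h ord0, [ffun j => h (lift ord0 j)])).
  case=> a h /=; rewrite ffunE unlift_none; congr (_, _).
  by apply/ffunP => j; rewrite !ffunE liftK.
move=> h; apply/ffunP => i; rewrite ffunE.
by case: unliftP => [j ->|->] //=; rewrite ffunE.
Qed.

Lemma iter_avgE (A : finType) (p : A -> R) (X : A -> V) k f K :
  iter k (avg p X) f K =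
  \sum_(h : {ffun 'I_k -> A}) (\prod_r p (h r)) * f (K + \sum_r X (h r)).
Proof.
elim: k K => [|k IH] K /=.
  rewrite (eq_bigr (fun=> f K)) => [|h _]; last by rewrite !big_ord0 mul1r addr0.
  by rewrite sumr_const card_ffun card_ord expn0.
rewrite (reindex _ (onW_bij _ (ffcons_bij A k))) /=.
rewrite -(pair_bigA _ (fun a h => (\prod_r p (ffcons (a, h) r)) * f (K + \sum_r X (ffcons (a, h) r)))) /=.
apply: eq_bigr => a _; rewrite IH mulr_sumr; apply: eq_bigr => h _.
rewrite !big_ord_recl !ffunE unlift_none /= mulrA addrA; congr (_ * _ * f (_ + _)).
  by apply: eq_bigr => i _; rewrite ffunE liftK.
by apply: eq_bigr => i _; rewrite ffunE liftK.
Qed.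

End AveragingOperators.

(** * Numerical bounds for exponential and logarithm *)

Section ExpLogBounds.
Variable R : realType.

Lemma ge0_deriv_ge (f df : R -> R) (b : R) :
  (forall x, 0 <= x <= b -> is_derive x 1 f (df x)) ->
  (forall x, 0 <= x <= b -> 0 <= df x) ->
  forall x, 0 <= x <= b -> f 0 <= f x.
Proof.
move=> fd df0 x /andP[x0 xb].
have inb y : y \in `[0, x] -> 0 <= y <= b.
  by rewrite in_itv /= => /andP[-> yx]; exact: le_trans xb.
have [||c cx] := @MVT_segment R f df 0 x x0.
- by move=> y yx; apply: fd; apply: inb; apply: subset_itv_oo_cc.
- apply: derivable_within_continuous => y yx.
  by have [] := fd y (inb _ yx).
rewrite subr0 => fx; rewrite -subr_ge0 fx mulr_ge0 // df0 //; exact: inb.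
Qed.

(** Two integrations starting from [expR x + expR (- x) <= 101 / 50] near 0. The loss of one percent
    over the Taylor coefficient is affordable, and steps can be made small enough for the range of
    [z]. *)
Lemma expR_sym_le (z : R) : `|z| <= 20^-1 -> expR z + expR (- z) <= 2 + 101 / 100 * z ^+ 2.
Proof.
wlog z0 : z / 0 <= z => [H|].
  case: (leP 0 z) => [/H //|z0]; rewrite -normrN => /H; rewrite oppr_ge0 opprK sqrrN.
  by rewrite addrC; apply; exact: ltW.
rewrite ger0_norm // => zb.
pose s (x : R) := 101 / 50 * x - (expR x - expR (- x)).
pose f (x : R) := 2 + 101 / 100 * x ^+ 2 - (expR x + expR (- x)).
have s0 x : 0 <= x <= 20^-1 -> 0 <= s x.
  move=> xb; have -> : 0 = s 0 by rewrite /s oppr0 subrr mulr0 subr0.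
  apply: (@ge0_deriv_ge s (fun x => 101 / 50 - (expR x + expR (- x))) (20^-1)) => // y.
    move=> _; apply: is_derive_eq; rewrite /GRing.scale /=; ring.
  case/andP=> y0 yb.
  have h1 := expR_ge1Dx y; have h2 := expR_ge1Dx (- y).
  have h3 := expRxMexpNx_1 y; have p1 := expR_gt0 y; have p2 := expR_gt0 (- y).
  have : expR y <= 20 / 19 by nra.
  have : expR (- y) <= 1 by nra.
  have : expR y * (1 - y) <= 1 by nra.
  have : expR (- y) * (1 + y) <= 1 by nra.
  nra.
have : f 0 <= f z.
  apply: (@ge0_deriv_ge f s (20^-1)) => [y _||]; [|exact: s0|by rewrite z0 zb].
  rewrite /f /s; apply: is_derive_eq; rewrite /GRing.scale /=; by field.
rewrite /f oppr0 expR0 expr0n /=; lra.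
Qed.

Lemma ln_onem_le (y : R) : 0 <= y < 1 -> ln (1 - y) <= - (y + y ^+ 2 / 2 + y ^+ 3 / 3).
Proof.
case/andP=> y0 y1.
pose f (x : R) := - (x + x ^+ 2 / 2 + x ^+ 3 / 3) - ln (1 - x).
have : f 0 <= f y.
  apply: (@ge0_deriv_ge f (fun x => (1 - x)^-1 - (1 + x + x ^+ 2)) y) => [x|x|]; last by rewrite y0 lexx.
    case/andP=> x0 xy; have px : 0 < 1 - x by lra.
    have dl := is_derive1_ln px.
    have d1 : is_derive x 1 (fun x : R => 1 - x) (- 1).
      apply: is_derive_eq; ring.
    have d2 := @is_derive1_comp R (@ln R) _ x _ _ dl d1.
    have -> : (1 - x)^-1 - (1 + x + x ^+ 2) =
       - (1 + x + x ^+ 2) - (- 1) * (1 - x)^-1 by ring.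
    rewrite /f; apply: is_deriveB; apply: is_derive_eq; rewrite /GRing.scale /=; first by field.
    by rewrite mulrC.
  case/andP=> x0 xy; have px : 0 < 1 - x by lra.
  have -> : (1 - x)^-1 - (1 + x + x ^+ 2) = x ^+ 3 / (1 - x) by field; lra.
  by rewrite divr_ge0 ?exprn_ge0 // ltW.
have -> : f 0 = 0 by rewrite /f subr0 ln1; field.
by rewrite /f subr_ge0.
Qed.

Lemma ln_1D_le (y : R) : 0 <= y -> ln (1 + y) <= y - y ^+ 2 / 2 + y ^+ 3 / 3.
Proof.
move=> y0.
pose f (x : R) := (x - x ^+ 2 / 2 + x ^+ 3 / 3) - ln (1 + x).
have : f 0 <= f y.
  apply: (@ge0_deriv_ge f (fun x => (1 - x + x ^+ 2) - (1 + x)^-1) y) => [x|x|]; last by rewrite y0 lexx.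
    case/andP=> x0 xy; have px : 0 < 1 + x by lra.
    have dl := is_derive1_ln px.
    have d1 : is_derive x 1 (fun x : R => 1 + x) 1.
      apply: is_derive_eq; ring.
    have d2 := @is_derive1_comp R (@ln R) _ x _ _ dl d1.
    rewrite -[X in _ - X]mul1r.
    rewrite /f; apply: is_deriveB; apply: is_derive_eq; rewrite /GRing.scale /=; first by field.
    by rewrite mulrC.
  case/andP=> x0 xy; have px : 0 < 1 + x by lra.
  have -> : (1 - x + x ^+ 2) - (1 + x)^-1 = x ^+ 3 / (1 + x) by field; lra.
  by rewrite divr_ge0 ?exprn_ge0 // ltW.
have -> : f 0 = 0 by rewrite /f addr0 ln1; field.
by rewrite /f subr_ge0.
Qed.

Lemma ln2_le : ln 2 <= 87 / 125 :> R.
Proof.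
have -> : (2 : R) = (1 + 4^-1) ^+ 3 * (1 + 3 / 125) by field.
rewrite lnM ?posrE ?exprn_gt0 //; try lra.
rewrite lnXn //; last lra.
have := @ln_1D_le (4^-1) ltac:(lra).
have : ln (1 + 3 / 125) <= 3 / 125 :> R by apply: le_ln1Dx; lra.
rewrite -[_ *+ 3]mulr_natl; lra.
Qed.

End ExpLogBounds.

(** * PAC-Bayes bound with a lattice prior *)

Section PacBayes.
Variable R : realType.

(** Bounds the entropy of a Bernoulli variable below by its variance. The cubic Taylor bounds of
    both logarithms add up to [8 / 3 * (f * (1 - f))] plus the nonnegative
    [f * (1 - f) * (1 - 2 * f) ^+ 2 / 6]. *)
Lemma entropy2_ge (f : R) : 0 <= f <= 1 ->
  (1 - f) * ln (1 - f) + f * ln f <= - (8 / 3 * (f * (1 - f))).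
Proof.
case/andP=> f0 f1.
have [->|fn0] := eqVneq f 0; first by rewrite subr0 ln1; lra.
have [->|fn1] := eqVneq f 1; first by rewrite subrr ln1; lra.
have {}f0 : 0 < f by rewrite lt0r fn0.
have {}f1 : f < 1 by rewrite lt_neqAle fn1.
have h1 := @ln_onem_le R f ltac:(lra).
have h2 := @ln_onem_le R (1 - f) ltac:(lra).
rewrite opprB addrCA subrr addr0 in h2.
have p1 : 0 <= (1 - f) * (- (f + f ^+ 2 / 2 + f ^+ 3 / 3) - ln (1 - f)) by apply: mulr_ge0; lra.
have p2 : 0 <= f * (- ((1 - f) + (1 - f) ^+ 2 / 2 + (1 - f) ^+ 3 / 3) - ln f) by apply: mulr_ge0; lra.
have p3 : 0 <= f * (1 - f) by apply: mulr_ge0; lra.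
have p4 : 0 <= f * (1 - f) * (1 - 2 * f) ^+ 2 by rewrite mulr_ge0 ?sqr_ge0.
have : (1 - f) * (f + f ^+ 2 / 2 + f ^+ 3 / 3) + f * ((1 - f) + (1 - f) ^+ 2 / 2 + (1 - f) ^+ 3 / 3)
  = 8 / 3 * (f * (1 - f)) + f * (1 - f) * (1 - 2 * f) ^+ 2 / 6 by field.
lra.
Qed.

Variable J0 : nat.
Definition lattice_pt (i : 'I_(2 * J0).+1) : R := i%:R - J0%:R.

(* [rho] rounds [m] at random to one of its two neighbouring lattice points;
   [v] is its variance. *)
Lemma rounding (m : R) : `|m| + 1 <= J0%:R ->
  exists (rho : 'I_(2 * J0).+1 -> R) (v : R),
   [/\ forall t, 0 <= rho t, \sum_t rho t = 1, \sum_t rho t * lattice_pt t = m,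
      \sum_t rho t * lattice_pt t ^+ 2 = m ^+ 2 + v & 0 <= v <= 4^-1
      /\ \sum_t rho t * ln (rho t) <= - (8 / 3 * v)].
Proof.
move=> mJ; have /andP[m1 m2] : - J0%:R + 1 <= m <= J0%:R - 1.
  by move: mJ; rewrite -lerBrDr ler_norml => /andP[]; lra.
have x0 : 0 <= m + J0%:R by lra.
pose j := Num.truncn (m + J0%:R); pose f := m + J0%:R - j%:R.
have /andP[j1 j2] := truncn_itv x0; rewrite -/j in j1 j2.
have f01 : 0 <= f <= 1 by rewrite /f; rewrite -natr1 in j2; lra.
have jlt : (j.+1 < (2 * J0).+1)%N.
  rewrite ltnS mul2n -addnn; have : j%:R + 1 <= J0%:R + J0%:R :> R by lra.
  by rewrite natr1 -natrD ler_nat.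
pose i0 := Ordinal (ltnW jlt); pose i1 := Ordinal jlt.
have i10 : i1 != i0 by rewrite -val_eqE /= -[j in X in _ != X]addn0 -addn1 eqn_add2l.
pose rho t : R := if t == i0 then 1 - f else if t == i1 then f else 0.
have S (h : 'I_(2 * J0).+1 -> R) : \sum_t rho t * h t = (1 - f) * h i0 + f * h i1.
  rewrite (bigD1 i0) //= /rho eqxx (bigD1 i1) //= (negPf i10) eqxx big1 ?addr0 //.
  by move=> t /andP[/negPf -> /negPf ->]; rewrite mul0r.
exists rho, (f * (1 - f)); split.
- by move=> t; rewrite /rho; case: ifP => _; [lra|case: ifP => _; lra].
- by under eq_bigr do rewrite -[rho _]mulr1; rewrite S; ring.
- by rewrite S /lattice_pt /= -natr1 /f; ring.
- by rewrite S /lattice_pt /= -natr1 /f; ring.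
split.
  apply/andP; split; first by apply: mulr_ge0; lra.
  by have := sqr_ge0 (1 - 2 * f); lra.
by rewrite S /rho eqxx (negPf i10) eqxx; exact: entropy2_ge.
Qed.

(* Gibbs variational inequality; [l w] stands for [ln (rho w)], and is only
   constrained where [rho w] is positive. *)
Lemma gibbs (W : finType) (rho F l : W -> R) : (forall w, 0 <= rho w) ->
  \sum_w rho w = 1 -> (forall w, 0 < rho w -> rho w = expR (l w)) ->
  expR (\sum_w rho w * (F w - l w)) <= \sum_w expR (F w).
Proof.
move=> rho0 rho1 rhol; set m := \sum_w _.
(* Tangent bound [1 + x <= expR x] at [x = F w - l w - m]; its linear part averages to zero because
   [m] is the mean. *)
apply: le_trans (_ : \sum_w rho w * expR m * (1 + (F w - l w - m)) <= _).
  rewrite (eq_bigr (fun w => expR m * (rho w * (F w - l w)) + expR m * (rho w * (1 - m)))); last first.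
    by move=> w _; ring.
  rewrite big_split -!mulr_sumr -mulr_suml rho1 /= -/m -mulrDr mul1r addrCA subrr addr0.
  by rewrite mulr1.
apply: ler_sum => w _.
have [z|nz] := eqVneq (rho w) 0; first by rewrite z !mul0r expR_ge0.
have rp : 0 < rho w by rewrite lt0r nz rho0.
rewrite [in leLHS]rhol // -expRD.
have -> : expR (F w) = expR (l w + m) * expR (F w - l w - m) by rewrite -expRD; congr expR; ring.
by rewrite ler_wpM2l ?expR_ge0 ?expR_ge1Dx.
Qed.

Variable d : nat.
Local Notation M := 'M[R]_d.+1.
Local Notation W := {ffun 'I_d.+1 -> 'I_(2 * J0).+1}.

Definition offdiag (G : M) (x : 'I_d.+1 -> R) : R :=
  \sum_a \sum_(b | b != a) G a b * (x a * x b).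

(** Half the second moment of [offdiag (z z^T) x] for a uniform sign vector [z]. *)
Definition offsq (x : 'I_d.+1 -> R) : R := \sum_a \sum_(b | b != a) x a ^+ 2 * x b ^+ 2.

Definition latvec (w : W) (a : 'I_d.+1) : R := lattice_pt (w a).

(* [sig * offsq] absorbs the moment generating function of [c * offdiag], and
   the last term makes the prior decay like [2 ^ (- |w|^2)]. *)
Definition pac_exponent (c sig : R) (G : M) (w : W) : R :=
  c * offdiag G (latvec w) - sig * offsq (latvec w) - ln 2 * \sum_a latvec w a ^+ 2.

(** Under independent roundings of the [m a], the off-diagonal form has mean exactly [offdiag G m],
    being a sum of products of distinct coordinates. Rounding enlarges the expected squared norm by
    [v], and the entropy gives [8 / 3 * v] back. *)
Lemma pac_bayes (c sig : R) (G : M) (m : 'I_d.+1 -> R) : 0 <= sig ->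
  (forall a, `|m a| + 1 <= J0%:R) ->
  exists2 v : R, 0 <= v <= d.+1%:R / 4 &
  c * offdiag G m <= ln (\sum_w expR (pac_exponent c sig G w))
    + sig * (\sum_a m a ^+ 2 + v) ^+ 2 + ln 2 * (\sum_a m a ^+ 2 + v) - 8 / 3 * v.
Proof.
move=> sig0 mJ.
have /fin_all_exists[rho /fin_all_exists[v H]] := fun a => rounding (mJ a).
exists (\sum_a v a).
  apply/andP; split; first by apply: sumr_ge0 => a _; have [_ _ _ _ [/andP[]]] := H a.
  apply: le_trans (_ : \sum_(a < d.+1) 4^-1 <= _); last first.
    by rewrite sumr_const card_ord mulr_natl.
  by apply: ler_sum => a _; have [_ _ _ _ [/andP[]]] := H a.
have rho0 a t : 0 <= rho a t by have [] := H a.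
have rho1 a : \sum_t rho a t = 1 by have [] := H a.
pose rw (w : W) := \prod_a rho a (w a).
pose lw (w : W) := \sum_a ln (rho a (w a)).
have key := @gibbs W rw (pac_exponent c sig G) lw.
have rw0 w : 0 <= rw w by apply: prodr_ge0.
have rw1 : \sum_w rw w = 1.
  by rewrite -[RHS](EE_cst rho1); apply: eq_bigr => w _; rewrite mulr1.
have rwl w : 0 < rw w -> rw w = expR (lw w).
  move=> rp; rewrite expR_sum; apply: eq_bigr => a _; rewrite lnK // posrE.
  rewrite lt0r rho0 andbT; apply: contraTneq rp => e.
  by rewrite /rw (bigD1 a) //= e mul0r ltxx.
have {}key := key rw0 rw1 rwl.
have Zpos : 0 < \sum_w expR (pac_exponent c sig G w) := lt_le_trans (expR_gt0 _) key.
move: key; rewrite -[X in _ <= X]lnK ?posrE // ler_expR => key.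
have E2 a : \sum_t rho a t * lattice_pt t ^+ 2 = m a ^+ 2 + v a by have [] := H a.
have E1 a : \sum_t rho a t * lattice_pt t = m a by have [] := H a.
have EEw (F : W -> R) : \sum_w rw w * F w = EE rho F by [].
have Hoff : EE rho (fun w => offdiag G (latvec w)) = offdiag G m.
  rewrite EE_sum; apply: eq_bigr => a _; rewrite EE_sum; apply: eq_bigr => b ba.
  rewrite EEZ (EE_coord2 rho1 (@lattice_pt) (@lattice_pt)) 1?eq_sym // !E1 //.
have Hsq : EE rho (fun w => \sum_a latvec w a ^+ 2) = \sum_a m a ^+ 2 + \sum_a v a.
  rewrite EE_sum -big_split; apply: eq_bigr => a _ /=.
  by rewrite (EE_coord rho1 a (fun t => lattice_pt t ^+ 2)) E2.
have Hoffsq : EE rho (fun w => offsq (latvec w)) <= (\sum_a m a ^+ 2 + \sum_a v a) ^+ 2.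
  rewrite EE_sum -big_split expr2 mulr_suml; apply: ler_sum => a _ /=.
  have e0 b : 0 <= m b ^+ 2 + v b.
    by rewrite -E2 sumr_ge0 // => t _; rewrite mulr_ge0 ?sqr_ge0.
  rewrite EE_sum mulr_sumr [leRHS](bigD1 a) //=.
  rewrite ler_wpDl ?mulr_ge0 // ler_sum // => b ba.
  rewrite (EE_coord2 rho1 (fun t => lattice_pt t ^+ 2) (fun t => lattice_pt t ^+ 2)) 1?eq_sym //.
  by rewrite !E2.
have Hl : EE rho lw <= - (8 / 3 * \sum_a v a).
  rewrite EE_sum mulr_sumr -sumrN; apply: ler_sum => a _.
  by rewrite (EE_coord rho1 a (fun t => ln (rho a t))); have [_ _ _ _ []] := H a.
move: key; rewrite EEw EEB /pac_exponent EEB EEB !EEZ Hoff Hsq.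
have : sig * EE rho (fun w => offsq (latvec w)) <= sig * (\sum_a m a ^+ 2 + \sum_a v a) ^+ 2.
  by rewrite ler_wpM2l.
lra.
Qed.

(** The first two terms give [1 / 2 + 1 / 16]. Since [(k + 3) ^ 2 >= 9 + 3 * k], the rest is at most
    a geometric series with sum [2 ^ (- 9) / (1 - 1 / 8) = 1 / 448]. *)
Lemma sum_half_sqr_le n : \sum_(i < n) (2^-1 : R) ^+ (i.+1 ^ 2) <= 9 / 16 + 448^-1.
Proof.
have tail k : \sum_(i < k) (2^-1 : R) ^+ (i.+3 ^ 2) <= 448^-1.
  apply: le_trans (_ : 448^-1 * (1 - (8^-1) ^+ k) <= _); last first.
    have k0 : 0 <= (8^-1 : R) ^+ k by rewrite exprn_ge0 // invr_ge0.
    lra.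
  elim: k => [|k IH]; first by rewrite big_ord0 expr0 subrr mulr0.
  rewrite big_ord_recr /= exprS; move: IH.
  have : (2^-1 : R) ^+ (k.+3 ^ 2) <= (2^-1) ^+ (9 + 3 * k).
    have nk : (9 + 3 * k <= k.+3 ^ 2)%N by rewrite -mulnn; nia.
    by rewrite ler_wiXn2l //; lra.
  rewrite exprD exprM (_ : (2^-1 : R) ^+ 3 = 8^-1); last by field.
  rewrite (_ : (2^-1 : R) ^+ 9 = 512^-1); last by field.
  lra.
have h : \sum_(i < n) (2^-1 : R) ^+ (i.+1 ^ 2) <= \sum_(i < n.+2) (2^-1 : R) ^+ (i.+1 ^ 2).
  by rewrite !big_ord_recr /= -addrA lerDl addr_ge0 // exprn_ge0 // invr_ge0.
apply: le_trans h _.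
have -> : \sum_(i < n.+2) (2^-1 : R) ^+ (i.+1 ^ 2) = 2^-1 + (2^-1 ^+ 4 + \sum_(i < n) (2^-1) ^+ (i.+3 ^ 2)).
  by rewrite 2!big_ord_recl; congr (_ + (_ + _)).
have := tail n; have -> : (2^-1 : R) ^+ 4 = 16^-1 by field.
lra.
Qed.

(** The lattice is symmetric, so the constant is [1 + 2 * (9 / 16 + 1 / 448)]. *)
Lemma sum_prior_le : \sum_(i < (2 * J0).+1) expR (- (ln 2 * lattice_pt i ^+ 2)) <= 477 / 224.
Proof.
have ptE (n : nat) : expR (- (ln 2 * n%:R ^+ 2)) = (2^-1 : R) ^+ (n ^ 2).
  by rewrite -natrX mulrC -mulrN -mulrC expRM_natr expRN lnK // posrE.
rewrite /lattice_pt -(big_mkord xpredT (fun i : nat => expR (- (ln 2 * (i%:R - J0%:R) ^+ 2)))).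
rewrite (@big_cat_nat _ _ _ J0.+1) //=; last by lia.
rewrite big_mkord (reindex_inj rev_ord_inj) /=.
rewrite (eq_bigr (fun i : 'I_J0.+1 => (2^-1 : R) ^+ (i ^ 2))); last first.
  move=> i _; rewrite -(ptE i) subSS natrB; last by rewrite -ltnS.
  by rewrite (_ : J0%:R - i%:R - J0%:R = - i%:R) ?sqrrN //; ring.
rewrite big_ord_recl expr0.
rewrite [X in _ + X](_ : _ = \sum_(i < J0) (2^-1 : R) ^+ (i.+1 ^ 2)); last first.
  rewrite -{1}[J0.+1]add0n big_addn (_ : ((2 * J0).+1 - J0.+1)%N = J0); last by lia.
  by rewrite big_mkord; apply: eq_bigr => i _; rewrite -(ptE i.+1) -addSnnS natrD addrK.
have := sum_half_sqr_le J0.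
have -> : \sum_(i < J0) (2^-1 : R) ^+ (lift ord0 i ^ 2) = \sum_(i < J0) (2^-1) ^+ (i.+1 ^ 2).
  by apply: eq_bigr.
lra.
Qed.

End PacBayes.

(** An exponential of an additive functional is multiplied by the moment generating function of the
    increment at each step, whatever the current matrix. *)
Lemma iter_avg_expR (R : realType) (V : zmodType) (A : finType) (p : A -> R) (X : A -> V)
    (l : V -> R) (e b : R) m K :
  (forall a, 0 <= p a) -> (forall K a, l (K + X a) = l K + l (X a)) ->
  \sum_a p a * expR (l (X a)) <= expR b ->
  iter m (avg p X) (fun K => expR (l K + e)) K <= expR (l K + e + m%:R * b).
Proof.
move=> p0 lD lb; elim: m K => [|m IH] K; first by rewrite mul0r addr0.
rewrite iterS; apply: le_trans (_ : \sum_a p a * (expR (l K + e + m%:R * b) * expR (l (X a))) <= _).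
  apply: ler_sum => a _; rewrite ler_wpM2l //; apply: le_trans (IH _) _.
  by rewrite -expRD ler_expR lD; lra.
under eq_bigr do rewrite mulrCA.
rewrite -mulr_sumr -natr1 mulrDl mul1r addrA [leRHS]expRD.
by rewrite ler_wpM2l ?expR_ge0.
Qed.

(** * The random-sign model and its exponential moments *)

Section SignSteps.
Variables (R : realType) (d : nat).
Local Notation M := 'M[R]_d.+1.
Local Notation D := (d.+1%:R : R).

Definition sgn (b : bool) : R := if b then 1 else -1.
Definition coin (b : bool) : R := 2^-1.
Definition signvec (w : {ffun 'I_d.+1 -> bool}) : 'cV[R]_d.+1 := rvec sgn 1%:M w.
Local Notation E := (EE (fun _ : 'I_d.+1 => coin)).

Lemma coin_ge0 b : 0 <= coin b. Proof. by rewrite invr_ge0. Qed.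
Lemma coin1 : \sum_b coin b = 1.
Proof. by rewrite big_bool /coin /=; field. Qed.
Lemma coin_sgn1 : \sum_b coin b * sgn b = 0.
Proof. by rewrite big_bool /coin /sgn /=; field. Qed.
Lemma coin_sgn2 : \sum_b coin b * sgn b ^+ 2 = 1.
Proof. by rewrite big_bool /coin /sgn /=; field. Qed.
Lemma coin_sgn3 : \sum_b coin b * sgn b ^+ 3 = 0.
Proof. by rewrite big_bool /coin /sgn /=; field. Qed.
Lemma coin_sgn4 : \sum_b coin b * sgn b ^+ 4 = 1.
Proof. by rewrite big_bool /coin /sgn /=; field. Qed.

Lemma signvecE w a : signvec w a 0 = sgn (w a).
Proof. by rewrite /signvec /rvec trmx1 mul1mx mxE. Qed.

Lemma sgn_sqr b : sgn b * sgn b = 1.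
Proof. by case: b; rewrite /sgn; ring. Qed.

Lemma signvec_outer w a b :
  (signvec w *m (signvec w)^T) a b = sgn (w a) * sgn (w b).
Proof. by rewrite mxE big_ord1 [_^T _ _]mxE !signvecE. Qed.

Variable s : R.
Hypothesis s0 : 0 <= s.
Local Notation B := (bool * {ffun 'I_d.+1 -> bool})%type.
Definition sign_weight (b : B) : R := 2^-1 * \prod_i coin (b.2 i).
(** The extra Boolean is an overall sign, which centres the step. All diagonal entries of a step are
    equal to the same [s] or [- s], so a constant diagonal is preserved. *)
Definition sign_step (b : B) : M :=
  (if b.1 then s else - s) *: (signvec b.2 *m (signvec b.2)^T).
Local Notation TY := (avg sign_weight sign_step).

Lemma sign_weight_ge0 b : 0 <= sign_weight b.
Proof. by rewrite mulr_ge0 ?invr_ge0 // prodr_ge0 // => i _; exact: coin_ge0. Qed.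

Lemma sum_signE (F : B -> R) : \sum_b sign_weight b * F b =
  E (fun w => 2^-1 * (F (true, w) + F (false, w))).
Proof.
rewrite (eq_bigr (fun b => sign_weight (b.1, b.2) * F (b.1, b.2))); last by case.
rewrite -(pair_bigA _ (fun x w => sign_weight (x, w) * F (x, w))) /= big_bool /= -big_split.
by apply: eq_bigr => w _; rewrite /sign_weight /=; ring.
Qed.

Lemma sign_weight1 : \sum_b sign_weight b = 1.
Proof.
transitivity (\sum_b sign_weight b * 1); first by apply: eq_bigr => b _; rewrite mulr1.
rewrite sum_signE (eq_EE _ (G := fun=> 1)) => [|w]; last by field.
by rewrite EE_cst // => i; exact: coin1.
Qed.

Lemma avg_signE f K : TY f K = E (fun w =>
  2^-1 * (f (K + s *: (signvec w *m (signvec w)^T)) + f (K - s *: (signvec w *m (signvec w)^T)))).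
Proof.
rewrite /avg sum_signE; apply: eq_EE => w.
by rewrite /sign_step /= scaleNr.
Qed.

Lemma offdiagD (G H : M) x : offdiag (G + H) x = offdiag G x + offdiag H x.
Proof.
rewrite /offdiag -big_split; apply: eq_bigr => a _; rewrite -big_split.
by apply: eq_bigr => b _; rewrite mxE mulrDl.
Qed.

Lemma offdiagZ c (G : M) x : offdiag (c *: G) x = c * offdiag G x.
Proof.
rewrite /offdiag mulr_sumr; apply: eq_bigr => a _; rewrite mulr_sumr.
by apply: eq_bigr => b _; rewrite mxE -mulrA.
Qed.

Lemma offdiag_scalar c x : offdiag (c%:M : M) x = 0.
Proof.
rewrite /offdiag big1 // => a _; rewrite big1 // => b ba.
by rewrite mxE [a == b]eq_sym (negPf ba) mul0r.
Qed.

Lemma EE_offdiag2 (x : 'I_d.+1 -> R) :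
  E (fun w => offdiag (signvec w *m (signvec w)^T) x ^+ 2) = 2 * offsq x.
Proof.
pose N (a b : 'I_d.+1) : R := if b == a then 0 else x a * x b.
have OE w : offdiag (signvec w *m (signvec w)^T) x =
    \sum_a \sum_b N a b * (sgn (w a) * sgn (w b)).
  apply: eq_bigr => a _; rewrite big_mkcond; apply: eq_bigr => b _ /=.
  by rewrite signvec_outer /N; case: eqP => //= _; [rewrite mul0r|rewrite mulrC].
rewrite (eq_EE _ (G := fun w => (\sum_a \sum_b N a b * (sgn (w a) * sgn (w b))) *
   (\sum_a \sum_b N a b * (sgn (w a) * sgn (w b))))); last by move=> w; rewrite OE expr2.
rewrite (EE_quad2 coin1 coin_sgn1 coin_sgn2 coin_sgn3 coin_sgn4); last first.
  by move=> a b; rewrite /N eq_sym; case: eqP => // _; rewrite mulrC.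
have N0 a : N a a = 0 by rewrite /N eqxx.
have z1 : \sum_a N a a = 0 by rewrite big1.
have z2 : \sum_a N a a * N a a = 0 by rewrite big1 // => a _; rewrite N0 mul0r.
rewrite z1 z2 mul0r add0r expr1n mul1r mulr0 addr0; congr (_ * _).
rewrite /offsq; apply: eq_bigr => a _; rewrite [RHS]big_mkcond; apply: eq_bigr => b _ /=.
by rewrite /N; case: eqP => //= _; ring.
Qed.

Lemma sign_mgf_offdiag c (x : 'I_d.+1 -> R) :
  (forall w, `|c * (s * offdiag (signvec w *m (signvec w)^T) x)| <= 20^-1) ->
  \sum_b sign_weight b * expR (c * offdiag (sign_step b) x) <=
  expR (101 / 100 * (c * s) ^+ 2 * offsq x).
Proof.
move=> small; rewrite sum_signE.
apply: le_trans (_ : E (fun w => 1 + (101 / 200 * (c * s) ^+ 2) * offdiag (signvec w *m (signvec w)^T) x ^+ 2) <= _).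
  apply: le_EE => [i b|w]; first exact: coin_ge0.
  rewrite /sign_step /= !offdiagZ mulNr mulrN.
  have := expR_sym_le (small w).
  rewrite !exprMn; lra.
rewrite EED EE_cst; last by move=> _; exact: coin1.
rewrite EEZ EE_offdiag2; apply: le_trans (expR_ge1Dx _); lra.
Qed.

Lemma sign_mgf_diag q : `|q * s| <= 20^-1 ->
  \sum_b sign_weight b * expR (q * (sign_step b) 0 0) <= expR (101 / 200 * (q * s) ^+ 2).
Proof.
move=> small; rewrite sum_signE.
apply: le_trans (_ : E (fun w => 1 + 101 / 200 * (q * s) ^+ 2) <= _).
  apply: le_EE => [i b|w]; first exact: coin_ge0.
  have zE (c : R) (N : M) : (c *: N) 0 0 = c * N 0 0 by rewrite mxE.
  rewrite /sign_step /= !zE signvec_outer sgn_sqr.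
  have := expR_sym_le small; rewrite !mulr1 mulrN; lra.
by rewrite EE_cst; [exact: expR_ge1Dx | move=> _; exact: coin1].
Qed.

End SignSteps.

Lemma sum_exp_coeff_le (R : realType) (c : R) n : 0 <= c ->
  \sum_(j < n) c ^+ j / j`!%:R <= expR c.
Proof.
move=> c0; rewrite -(big_mkord xpredT (fun j => c ^+ j / j`!%:R)).
apply: (nondecreasing_cvgn_le (u_ := series (exp_coeff c))).
  by apply: nondecreasing_series => j _ _; rewrite /exp_coeff /= divr_ge0 // exprn_ge0.
exact: is_cvg_series_exp_coeff.
Qed.

(** * Positivity of rank-one perturbations of scalars *)

Section RankOnePsd.
Variables (R : realFieldType) (d : nat).
Implicit Types (x : 'cV[R]_d.+1).

Lemma qf_outer x u : qf (x *m x^T) u = bf 1 x u ^+ 2.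
Proof.
rewrite /qf /bf mulmx1 !mulmxA expr2 -mulmxA mxE big_ord1; congr (_ * _).
by rewrite -[u^T *m x]trmxK trmx_mul trmxK mxE.
Qed.

Lemma outer_sym x : (x *m x^T)^T = x *m x^T.
Proof. by rewrite trmx_mul trmxK. Qed.

Lemma psd1 : psd (1 : 'M[R]_d.+1).
Proof. exact: psd_scalar. Qed.

Lemma psd_outer x (c : R) : 0 <= c -> psd (c *: (x *m x^T)).
Proof.
move=> c0; split=> [|u]; first by rewrite linearZ /= outer_sym.
by rewrite qfZm qf_outer mulr_ge0 ?sqr_ge0.
Qed.

Lemma psd_scalar_sub_outer x (c s : R) : 0 <= s -> s * qf 1 x <= c ->
  psd (c%:M - s *: (x *m x^T)).
Proof.
move=> s0 xc; split=> [|u]; first by rewrite linearB /= tr_scalar_mx linearZ /= outer_sym.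
rewrite qfBm qf_scalar -qf1 qfZm qf_outer subr_ge0.
apply: le_trans (ler_wpM2l s0 (bf_CS x u psd1)) _.
by rewrite mulrA ler_wpM2r ?qf1_ge0.
Qed.

End RankOnePsd.

(** * Trace exponential of the random-sign model *)

Section TraceBound.
Variables (R : realType) (d : nat).
Local Notation M := 'M[R]_d.+1.
Local Notation D := (d.+1%:R : R).
Variables (p sig Gam prior : R).
Local Notation J0 := d.+2.
Hypothesis prior0 : 0 < prior.
Hypothesis sum_prior : \sum_(i < (2 * J0).+1) expR (- (ln 2 * lattice_pt R i ^+ 2)) <= prior.
Local Notation c := (p / (7 / 10 * D)).
Hypothesis p0 : 0 < p.
Hypothesis sig0 : 0 <= sig.
Hypothesis GamP : forall v, 0 <= v <= D / 4 ->
  sig * (7 / 10 * D + v) ^+ 2 + ln 2 * (7 / 10 * D + v) - 8 / 3 * v + D * ln prior <= Gam.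

Definition pac_sum (K : M) : R :=
  \sum_(w : {ffun 'I_d.+1 -> 'I_(2 * J0).+1}) expR (pac_exponent c sig K w).

Lemma pac_sum_gt0 K : 0 < pac_sum K.
Proof.
rewrite /pac_sum (bigD1 [ffun=> ord0]) //= ltr_pwDl ?expR_gt0 //.
by apply: sumr_ge0 => w _; exact: expR_ge0.
Qed.

(** [pac_bayes] is applied to [u] rescaled to squared norm [7 / 10 * D]. Since [c] is [p] divided by
    that norm, undoing the scaling gives the factor [p^-1]. *)
Lemma offdiag_le (K : M) (u : 'cV[R]_d.+1) :
  offdiag K (fun a => u a 0) <= p^-1 * (ln (pac_sum K) - D * ln prior + Gam) * qf 1 u.
Proof.
have D0 : 1 <= D by rewrite ler1n.
set S := qf 1 u; have S0 : 0 <= S by exact: qf1_ge0.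
have [Sz|Sn] := eqVneq S 0.
  have uz a : u a 0 = 0.
    apply/eqP; rewrite -sqrf_eq0; apply/eqP.
    move: Sz; rewrite /S qf1 => /eqP; rewrite psumr_eq0; last by move=> *; exact: sqr_ge0.
    by move=> /allP /(_ a (mem_index_enum a)) /implyP /(_ isT) /eqP.
  rewrite Sz mulr0 /offdiag big1 // => a _; rewrite big1 // => b _.
  by rewrite !uz !mulr0.
have Sp : 0 < S by rewrite lt0r Sn.
pose b := 7 / 10 * D / S; have b0 : 0 < b by rewrite /b divr_gt0 //; lra.
pose m a := Num.sqrt b * u a 0.
have m2 : \sum_a m a ^+ 2 = 7 / 10 * D.
  under eq_bigr do rewrite exprMn sqr_sqrtr ?(ltW b0) //.
  by rewrite -mulr_sumr -qf1 -/S /b divfK.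
(* [m a ^+ 2 <= 7 / 10 * D <= D ^+ 2], so the half-width [J0 = D + 1] leaves room for rounding to
   either neighbour. *)
have mJ a : `|m a| + 1 <= (J0)%:R.
  rewrite -natr1 lerD2r -ler_sqr ?nnegrE ?normr_ge0 // real_normK ?num_real //.
  have : m a ^+ 2 <= 7 / 10 * D.
    by rewrite -m2 (bigD1 a) //= lerDl sumr_ge0 // => i _; exact: sqr_ge0.
  nra.
have [v vD] := pac_bayes c K sig0 mJ.
rewrite -/(pac_sum K) m2 => H; have := GamP vD; set g := Gam => Hg.
have offm : offdiag K m = b * offdiag K (fun a => u a 0).
  rewrite /offdiag mulr_sumr; apply: eq_bigr => i _; rewrite mulr_sumr; apply: eq_bigr => j _.
  by rewrite /m mulrACA -expr2 sqr_sqrtr ?(ltW b0) //; ring.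
have cb : c * b = p / S by rewrite /b; field; rewrite Sn /=; lra.
rewrite offm mulrA cb in H.
move: H; set O := offdiag K _ => H.
have -> : O = p^-1 * (p / S * O) * S by field; rewrite Sn gt_eqF.
by rewrite ler_wpM2r // ler_wpM2l ?invr_ge0 ?(ltW p0) //; lra.
Qed.

Lemma qf_const_diag (K : M) (u : 'cV[R]_d.+1) : (forall a, K a a = K 0 0) ->
  qf K u = K 0 0 * qf 1 u + offdiag K (fun a => u a 0).
Proof.
move=> Kd; rewrite [qf K u]bfE qf1 mulr_sumr /offdiag -big_split; apply: eq_bigr => a _ /=.
by rewrite (bigD1 a) //= Kd expr2.
Qed.

Lemma trexp_pac (K : M) J : psd K -> (forall a, K a a = K 0 0) ->
  trexp J K <= D * expR (K 0 0 + p^-1 * (ln (pac_sum K) - D * ln prior + Gam)).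
Proof.
move=> pK Kd; set e := _ + _.
have pe : psd (e%:M - K).
  split; first by rewrite linearB /= tr_scalar_mx pK.1.
  move=> u; rewrite qfBm qf_scalar -qf1 (qf_const_diag u Kd) subr_ge0 /e mulrDl lerD2l.
  exact: offdiag_le.
have e0 : 0 <= e.
  have := pe.2 (delta_mx 0 0); rewrite qfBm qf_delta qf_delta mxE eqxx subr_ge0.
  by apply: le_trans; exact: psd_diag.
apply: le_trans (_ : \sum_(j < J.+1) D * (e ^+ j / j`!%:R) <= _).
  apply: ler_sum => j _; rewrite mulrA ler_wpM2r ?invr_ge0 //.
  exact: tr_powX_le.
by rewrite -mulr_sumr ler_wpM2l // sum_exp_coeff_le.
Qed.

Section Iterate.
Variables (s q C : R) (n : nat).
Local Notation b := (101 / 200 * (q * s) ^+ 2).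
Hypotheses (s0 : 0 <= s) (p1 : 1 < p) (pq : p^-1 + q^-1 = 1) (qs : `|q * s| <= 20^-1).
Hypothesis sigE : sig = 101 / 100 * (c * s) ^+ 2 * n%:R.
Hypothesis small : c * (s * (D ^+ 2 * J0%:R ^+ 2)) <= 20^-1.
Hypothesis C0 : n%:R * (s * D) <= C.
Local Notation TY := (avg (@sign_weight R d) (@sign_step R d s)).

(** Convexity of [expR], from its two tangent bounds at the weighted mean. *)
Let young (a e : R) : expR (p^-1 * a + q^-1 * e) <= p^-1 * expR a + q^-1 * expR e.
Proof.
have tangent (x m : R) : expR m * (1 + (x - m)) <= expR x.
  by rewrite -[X in _ <= expR X](subrKC m) expRD ler_wpM2l ?expR_ge0 ?expR_ge1Dx.
set m := _ + _; have h1 := tangent a m; have h2 := tangent e m.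
have ip : 0 < p^-1 by rewrite invr_gt0.
have iq : 0 <= q^-1.
  have : p^-1 <= 1 by rewrite invf_le1 // ltW.
  by rewrite -pq; lra.
have := ler_wpM2l (ltW ip) h1; have := ler_wpM2l iq h2.
have -> : q^-1 = 1 - p^-1 by rewrite -pq; ring.
rewrite /m (_ : q^-1 = 1 - p^-1); last by rewrite -pq; ring.
move: (expR _) => E; lra.
Qed.

Lemma lattice_pt_norm (i : 'I_(2 * J0).+1) : `|lattice_pt R i| <= J0%:R.
Proof.
rewrite /lattice_pt ler_norml; apply/andP; split; first by rewrite lerBrDr addNr.
by rewrite lerBlDr -natrD ler_nat addnn -mul2n -ltnS.
Qed.

(** At each lattice point the growth of the moment generating function over [n] steps is cancelled
    by [sig * offsq], by the choice [sigE]. The prior weights remain, and their sum factorises over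
    coordinates. *)
Lemma iter_pac_sum_le : iter n TY pac_sum C%:M <= prior ^+ d.+1.
Proof.
rewrite /pac_sum iter_avg_sum.
apply: le_trans (_ : \sum_(w : {ffun 'I_d.+1 -> 'I_(2 * J0).+1}) \prod_a expR (- (ln 2 * lattice_pt R (w a) ^+ 2)) <= _).
  apply: ler_sum => w _.
  have mgf := @sign_mgf_offdiag R d s c (latvec R w).
  pose e := - (sig * offsq (latvec R w)) - ln 2 * \sum_a latvec R w a ^+ 2.
  have fe : (fun K : M => expR (pac_exponent c sig K w)) =1
      (fun K : M => expR (c * offdiag K (latvec R w) + e)).
    by move=> K; rewrite /pac_exponent /e addrA.
  rewrite (eq_iter_avg _ _ n fe).
  have sm y : `|c * (s * offdiag (signvec R y *m (signvec R y)^T) (latvec R w))| <= 20^-1.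
    have c0 : 0 <= c by rewrite divr_ge0 ?(ltW p0) // mulr_ge0 //; lra.
    rewrite normrM (ger0_norm c0) normrM (ger0_norm s0); apply: le_trans small.
    rewrite ler_wpM2l // ler_wpM2l //.
    apply: le_trans (ler_norm_sum _ _ _) _.
    apply: le_trans (_ : \sum_(a < d.+1) \sum_(a < d.+1) J0%:R ^+ 2 <= _); last first.
      by rewrite !sumr_const card_ord -mulrnA -[leLHS]mulr_natl natrM -expr2.
    apply: ler_sum => a _; apply: le_trans (ler_norm_sum _ _ _) _.
    rewrite [leRHS](bigID (fun b => b != a)) /= ler_wpDr ?sumr_ge0 //.
      by move=> *; exact: sqr_ge0.
    apply: ler_sum => b' _; rewrite signvec_outer !normrM expr2.
    have sg x : `|sgn R x| = 1 by case: x; rewrite /sgn ?normrN1 ?normr1.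
    by rewrite !sg !mul1r ler_pM // lattice_pt_norm.
  have lD (K : M) a : c * offdiag (K + sign_step s a) (latvec R w) =
      c * offdiag K (latvec R w) + c * offdiag (sign_step s a) (latvec R w).
    by rewrite offdiagD mulrDr.
  apply: le_trans (iter_avg_expR e n C%:M (@sign_weight_ge0 R d) lD (mgf sm)) _.
  rewrite offdiag_scalar mulr0 add0r -expR_sum ler_expR /e sigE sumrN -mulr_sumr.
  by rewrite le_eqVlt; apply/orP; left; apply/eqP; rewrite /latvec; ring.
rewrite -(bigA_distr_bigA (fun (a : 'I_d.+1) i => expR (- (ln 2 * lattice_pt R i ^+ 2)))).
rewrite prodr_const card_ord lerXn2r ?nnegrE ?(ltW prior0) //.
by apply: sumr_ge0 => i _; exact: expR_ge0.
Qed.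

Lemma iter_diag_le : iter n TY (fun K => expR (q * K 0 0 - q * C)) C%:M <= expR (n%:R * b).
Proof.
have lD (K : M) a : q * (K + sign_step s a) 0 0 = q * K 0 0 + q * (sign_step s a) 0 0.
  by rewrite mxE mulrDr.
apply: le_trans (iter_avg_expR (l := fun K : M => q * K 0 0) (- (q * C)) n C%:M (@sign_weight_ge0 R d) lD (@sign_mgf_diag R d s q qs)) _.
by rewrite mxE eqxx mulr1n subrr add0r.
Qed.

Lemma qf1_signvec (w : {ffun 'I_d.+1 -> bool}) : qf 1 (signvec R w) = D.
Proof.
rewrite qf1 (eq_bigr (fun=> 1)); last by move=> a _; rewrite signvecE expr2 sgn_sqr.
by rewrite sumr_const card_ord.
Qed.

Lemma psd_sign_step_add (B : bool * {ffun 'I_d.+1 -> bool}) :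
  psd ((s * D)%:M + sign_step s B).
Proof.
case: B => [[] w]; rewrite /sign_step /=; last first.
  by rewrite scaleNr; apply: psd_scalar_sub_outer => //; rewrite qf1_signvec.
by apply: psdD; [apply: psd_scalar; rewrite mulr_ge0 | exact: psd_outer].
Qed.

Lemma iter_trexp_le J :
  iter n TY (trexp J) C%:M <= D * expR (C + p^-1 * Gam + q^-1 * (n%:R * b)).
Proof.
have qn0 : q != 0.
  apply: contra_eq_neq pq => ->; rewrite invr0 addr0 invr_eq1.
  by rewrite gt_eqF.
(* [s * D] is the operator norm of one sign step, so this reserve suffices for [m] more of them. *)
pose Dom m (K : M) := psd (K - (m%:R * (s * D))%:M) /\ forall a, K a a = K 0 0.
have DomS m K a : Dom m.+1 K -> Dom m (K + sign_step s a).
  case=> pK Kd; split.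
    have -> : K + sign_step s a - (m%:R * (s * D))%:M =
        (K - (m.+1%:R * (s * D))%:M) + ((s * D)%:M + sign_step s a).
      rewrite -[m.+1%:R]natr1 mulrDl mul1r raddfD /= opprD !addrA subrK.
      by rewrite addrAC.
    by apply: psdD => //; exact: psd_sign_step_add.
  have zE (e : R) (N : M) i : (e *: N) i i = e * N i i by rewrite mxE.
  move=> i; rewrite [LHS]mxE [RHS]mxE Kd /sign_step !zE !signvec_outer !sgn_sqr.
  by [].
set nb := n%:R * b; set E0 := expR _.
(* Each exponential is divided by the bound on its own mean. After averaging the two weights add up
   to [p^-1 + q^-1 = 1], which recovers what Hoelder's inequality would give. *)
pose g K := D * E0 * (p^-1 / prior ^+ d.+1) * pac_sum K + 
   D * E0 * (q^-1 * expR (- nb)) * expR (q * K 0 0 - q * C).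
have fg K : Dom 0%N K -> trexp J K <= g K.
  case; rewrite mul0r raddf0 subr0 => pK Kd.
  apply: le_trans (trexp_pac J pK Kd) _; rewrite /g -!mulrA -mulrDr ler_wpM2l //.
  set S := pac_sum K; have S0 : 0 < S by exact: pac_sum_gt0.
  have -> : K 0 0 + p^-1 * (ln S - D * ln prior + Gam) =
    (C + p^-1 * Gam + q^-1 * nb) +
    (p^-1 * (ln S - D * ln prior) + q^-1 * (q * K 0 0 - q * C - nb)).
    by field; rewrite qn0 gt_eqF.
  rewrite expRD -/E0 -mulrDr ler_wpM2l ?expR_ge0 //.
  apply: le_trans (young _ _) _; rewrite le_eqVlt; apply/orP; left; apply/eqP.
  rewrite expRB lnK ?posrE // mulrC [D * _]mulrC expRM_natr lnK ?posrE //.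
  rewrite expRB expRN. ring.
apply: le_trans (iter_avg_le (@sign_weight_ge0 R d) DomS (m := n) (r := 0) fg _) _.
  split; last by move=> a; rewrite !mxE !eqxx.
  by rewrite addn0 -raddfB; apply: psd_scalar; rewrite subr_ge0.
rewrite /g iter_avgD.
have lin e f K : iter n TY (fun K => e * f K) K = e * iter n TY f K.
  rewrite -[RHS]addr0 -(iter_avg_affine _ (@sign_weight1 R d)).
  by apply: eq_iter_avg => K'; rewrite addr0.
rewrite !lin.
have h1 := iter_pac_sum_le; have h2 := iter_diag_le.
have E00 : 0 <= D * E0 by rewrite mulr_ge0 ?expR_ge0.
have ip : 0 <= p^-1 by rewrite invr_ge0 ltW.
have iq : 0 <= q^-1.
  have : p^-1 <= 1 by rewrite invf_le1 // ltW.
  by rewrite -pq; lra.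
rewrite [leRHS](_ : _ = D * E0 * p^-1 + D * E0 * q^-1); last by rewrite -mulrDr pq mulr1.
move: (D * E0) E00 => e e0; apply: lerD; rewrite -!mulrA ler_wpM2l // -[leRHS]mulr1 ler_wpM2l //.
  by rewrite mulrC ler_pdivrMr ?mul1r ?exprn_gt0.
by rewrite expRN mulrC ler_pdivrMr ?expR_gt0 // mul1r; exact: h2.
Qed.

End Iterate.

End TraceBound.

(** * Accumulated second-order gain of the sign steps *)

Section SignLower.
Variables (R : realType) (d : nat) (s beta : R).
Local Notation M := 'M[R]_d.+1.
Local Notation D := (d.+1%:R : R).
Hypotheses (s0 : 0 <= s) (sb : s * D <= beta).
Local Notation TY := (avg (@sign_weight R d) (@sign_step R d s)).

Lemma psd_sub_scalar_step (m r : nat) (K E : M) :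
  psd (K - ((r + m)%:R * beta)%:M) -> psd ((r%:R * beta)%:M + E) ->
  psd (K + E - (m%:R * beta)%:M).
Proof.
move=> pK pE; have -> : K + E - (m%:R * beta)%:M =
    (K - ((r + m)%:R * beta)%:M) + ((r%:R * beta)%:M + E).
  rewrite natrD mulrDl raddfD /= opprD !addrA.
  by rewrite [K - _ - _]addrAC subrK addrAC.
exact: psdD.
Qed.

Lemma psd_scalar_le (a b : R) (E : M) : a <= b -> psd (a%:M + E) -> psd (b%:M + E).
Proof.
move=> ab pE; have -> : b%:M + E = (b - a)%:M + (a%:M + E).
  by rewrite addrA -raddfD /= subrK.
by apply: psdD => //; apply: psd_scalar; rewrite subr_ge0.
Qed.

Lemma psd_weaken (m : nat) (K : M) : psd (K - (m%:R * beta)%:M) -> psd K.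
Proof.
move=> pK; have b0 : 0 <= beta by apply: le_trans sb; rewrite mulr_ge0.
by rewrite -[K](subrK (m%:R * beta)%:M); apply: psdD => //; apply: psd_scalar; rewrite mulr_ge0.
Qed.

(** Each step gains [s ^+ 2 * convexp] at its current matrix, and [convexp] does not decrease in
    mean, so all gains can be charged to the initial [K]. *)
Lemma iter_sign_lower J m (K : M) : psd (K - (m%:R * beta)%:M) ->
  trexp J K + m%:R * s ^+ 2 * convexp J K <= iter m TY (trexp J) K.
Proof.
elim: m K => [|m IH] K pK; first by rewrite mul0r mul0r addr0.
have step b : psd (K + sign_step s b - (m%:R * beta)%:M).
  apply: (psd_sub_scalar_step (r := 1)) => //; rewrite mul1r.
  by apply: psd_scalar_le sb _; exact: psd_sign_step_add.
rewrite iterS; apply: le_trans (_ : TY (fun K => trexp J K + m%:R * s ^+ 2 * convexp J K) K <= _); last first.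
  by apply: ler_sum => b _; rewrite ler_wpM2l ?sign_weight_ge0 // IH.
have -> : TY (fun K => trexp J K + m%:R * s ^+ 2 * convexp J K) K =
   TY (trexp J) K + m%:R * s ^+ 2 * TY (convexp J) K.
  rewrite /avg mulr_sumr -big_split; apply: eq_bigr => b _ /=; ring.
have pK0 := psd_weaken pK.
have pm w : psd (K - s *: (signvec R w *m (signvec R w)^T)).
  by have := psd_weaken (step (false, w)); rewrite /sign_step /= scaleNr.
have pp w : psd (K + s *: (signvec R w *m (signvec R w)^T)).
  by have := psd_weaken (step (true, w)).
have QQ : (1%:M : M)^T *m 1%:M = 1%:M by rewrite trmx1 mul1mx.
have row1 r : qf 1 (row r (1%:M : M))^T <= 1.
  rewrite qf1 (bigD1 r) //= !mxE eqxx big1 ?addr0 ?expr1n // => i ir.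
  by rewrite !mxE eq_sym (negPf ir) expr0n.
have h1 := @EE_trexp_lower _ _ _ _ _ _ _ _ (@coin_ge0 R) (@coin1 R) (@coin_sgn1 R)
   (@coin_sgn2 R) (@coin_sgn3 R) (@coin_sgn4 R) _ QQ K s J pK0 s0 erefl erefl pm pp row1.
have h2 := @EE_convexp_lower _ _ _ _ _ _ (@coin_ge0 R) (@coin1 R) 1%:M K s J pK0 s0 pm pp.
rewrite -!avg_signE in h1 h2.
have : m%:R * s ^+ 2 * convexp J K <= m%:R * s ^+ 2 * TY (convexp J) K.
  by rewrite ler_wpM2l // mulr_ge0 ?sqr_ge0.
rewrite -natr1; lra.
Qed.

End SignLower.

Lemma exp_coeff_limit_le (R : realType) (P c A B r : R) : 0 <= P -> 0 <= c -> 
  (forall J, P * \sum_(j < J.+1) c ^+ j / j`!%:R <= A + B * (r ^+ J / J`!%:R)) ->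
  P * expR c <= A.
Proof.
move=> P0 c0 H.
have c1 : (P * series (exp_coeff c) J.+1 @[J --> \oo] --> P * expR c)%classic.
  by apply: cvgMr; rewrite cvg_shiftS; exact: is_cvg_series_exp_coeff.
have c2 : (A + B * exp_coeff r J @[J --> \oo] --> A + B * 0)%classic.
  by apply: cvgD; [exact: cvg_cst|apply: cvgMr; exact: cvg_exp_coeff].
rewrite mulr0 addr0 in c2.
apply: (ler_cvg_to c1 c2).
near=> J; have := H J; rewrite /series /= /exp_coeff big_mkord //.
Unshelve. all: by end_near.
Qed.

(** * Moments of the sparse entries; the embedding as a sum of independent rows *)

Section Embedding.
Variables (R : realType) (n d k : nat) (Q : 'M[R]_(n, d.+1)) (zeta : R).
Hypothesis QQ : Q^T *m Q = 1%:M.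
Hypothesis zeta0 : 0 < zeta.
Hypothesis zetak : zeta <= k%:R.
Local Notation M := 'M[R]_d.+1.
Local Notation D := (d.+1%:R : R).
Local Notation T := (bool * bool)%type.

Let k0 : 0 < k%:R :> R. Proof. exact: lt_le_trans zetak. Qed.

Definition entry_weight (t : T) : R :=
  (if t.1 then zeta / k%:R else 1 - zeta / k%:R) * 2^-1.
Definition entry (t : T) : R := (Num.sqrt k%:R)^-1 * (Num.sqrt (k%:R / zeta) *
  ((if t.1 then 1 else 0) * (if t.2 then 1 else -1))).

Lemma sum_bool2 (F : T -> R) :
  \sum_t F t = F (true, true) + F (true, false) + F (false, true) + F (false, false).
Proof.
rewrite (eq_bigr (fun t => F (t.1, t.2))); last by case.
rewrite -(pair_bigA _ (fun x y => F (x, y))) /= big_bool /= !big_bool /=; ring.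
Qed.

Lemma entry_weight_ge0 t : 0 <= entry_weight t.
Proof.
rewrite mulr_ge0 ?invr_ge0 //; case: ifP => _; first by rewrite divr_ge0 ?ltW.
by rewrite subr_ge0 ler_pdivrMr ?mul1r.
Qed.

Lemma entry_weight1 : \sum_t entry_weight t = 1.
Proof. by rewrite sum_bool2 /entry_weight /=; field; rewrite gt_eqF. Qed.

Let c := (Num.sqrt k%:R)^-1 * Num.sqrt (k%:R / zeta).
Let c2 : c ^+ 2 = zeta^-1.
Proof.
rewrite exprMn exprVn !sqr_sqrtr ?(ltW k0) ?divr_ge0 ?(ltW k0) ?ltW //.
by rewrite mulrA mulVf ?mul1r // gt_eqF.
Qed.

Let entryE t : entry t = c * ((if t.1 then 1 else 0) * (if t.2 then 1 else -1)).
Proof. by rewrite /entry /c mulrA. Qed.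

Lemma entry_mean : \sum_t entry_weight t * entry t = 0.
Proof. by rewrite sum_bool2 /entry_weight !entryE /=; ring. Qed.
Lemma entry_var : \sum_t entry_weight t * entry t ^+ 2 = k%:R^-1.
Proof.
rewrite sum_bool2 /entry_weight !entryE /= !(exprMn _ c) c2; field.
by rewrite !gt_eqF.
Qed.
Lemma entry_third : \sum_t entry_weight t * entry t ^+ 3 = 0.
Proof. by rewrite sum_bool2 /entry_weight !entryE /=; ring. Qed.
Lemma entry_fourth : \sum_t entry_weight t * entry t ^+ 4 = (zeta * k%:R)^-1.
Proof.
rewrite sum_bool2 /entry_weight !entryE /= !(exprMn _ c).
have -> : c ^+ 4 = zeta ^- 2 by rewrite (exprM c 2 2) c2 exprVn.
by field; rewrite !gt_eqF.
Qed.

Definition rows_of (w : outcome k n) : {ffun 'I_k -> {ffun 'I_n -> T}} :=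
  [ffun r => [ffun i => w (r, i)]].

Lemma rows_of_bij : bijective rows_of.
Proof.
exists (fun h : {ffun 'I_k -> {ffun 'I_n -> T}} => [ffun ri => h ri.1 ri.2]).
  by move=> w; apply/ffunP => [[r i]]; rewrite !ffunE.
by move=> h; apply/ffunP => r; apply/ffunP => i; rewrite !ffunE.
Qed.

Definition row_weight (a : {ffun 'I_n -> T}) : R := \prod_i entry_weight (a i).

Lemma weight_rows w : weight zeta w = \prod_r row_weight (rows_of w r).
Proof.
rewrite /weight (eq_bigr (fun ri => entry_weight (w (ri.1, ri.2)))); last by case.
rewrite -(pair_bigA _ (fun r i => entry_weight (w (r, i)))) /=.
by apply: eq_bigr => r _; apply: eq_bigr => i _; rewrite !ffunE.
Qed.

Lemma row_weight_ge0 a : 0 <= row_weight a.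
Proof. by apply: prodr_ge0 => i _; exact: entry_weight_ge0. Qed.

Lemma weight_ge0 (w : outcome k n) : 0 <= weight zeta w.
Proof. by rewrite weight_rows; apply: prodr_ge0 => r _; exact: row_weight_ge0. Qed.

Lemma row_weight1 : \sum_a row_weight a = 1.
Proof.
by rewrite /row_weight -(bigA_distr_bigA (fun i t => entry_weight t)) big1 // => i _; exact: entry_weight1.
Qed.

Lemma weight1 : \sum_(w : outcome k n) weight zeta w = 1.
Proof.
transitivity (\sum_(h : {ffun 'I_k -> {ffun 'I_n -> T}}) \prod_r row_weight (h r)).
  rewrite (reindex rows_of (onW_bij _ rows_of_bij)) /=.
  by apply: eq_bigr => w _; exact: weight_rows.
rewrite -(bigA_distr_bigA (fun r a => row_weight a)) big1 // => r _.
exact: row_weight1.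
Qed.

Local Notation z := (rvec entry Q).
Variable th : R.
Hypothesis th0 : 0 < th.
Definition row_step (a : {ffun 'I_n -> T}) : M := - (th *: (z a *m (z a)^T)).
Local Notation TX := (avg row_weight row_step).

Lemma expect_rows (f : M -> R) (K : M) : \sum_(w : outcome k n) weight zeta w *
  f (K + \sum_r row_step (rows_of w r)) = iter k TX f K.
Proof.
rewrite iter_avgE.
rewrite (reindex rows_of (onW_bij _ rows_of_bij)) /=.
by apply: eq_bigr => w _; rewrite weight_rows.
Qed.

Lemma sqnorm_embedding (w : outcome k n) (u : 'cV[R]_d.+1) :
  sqnorm (sparse_embedding zeta w *m Q *m u) =
  \sum_r qf (z (rows_of w r) *m (z (rows_of w r))^T) u.
Proof.
apply: eq_bigr => r _; rewrite qf_outer; congr (_ ^+ 2).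
rewrite /bf mulmx1 /rvec trmx_mul trmxK -!mulmxA [LHS]mxE [RHS]mxE.
by apply: eq_bigr => i _; congr (_ * _); rewrite !mxE !ffunE.
Qed.

Lemma qf_rows (w : outcome k n) u (C : R) :
  qf (C%:M + \sum_r row_step (rows_of w r)) u =
  C * qf 1 u - th * sqnorm (sparse_embedding zeta w *m Q *m u).
Proof.
rewrite qfDm qf_scalar -qf1 qf_sum sqnorm_embedding mulr_sumr -sumrN; congr (_ + _).
by apply: eq_bigr => r _; rewrite qfNm qfZm.
Qed.

Lemma coherence_row r : qf 1 (row r Q)^T <= coherence Q.
Proof.
have -> : qf 1 (row r Q)^T = sqnorm (row r Q)^T by rewrite qf1.
by rewrite /coherence; apply: (le_bigmax _ (fun i => sqnorm (row i Q)^T)).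
Qed.

Lemma coherence_ge0 : 0 <= coherence Q.
Proof. exact: bigmax_ge_id. Qed.

End Embedding.

(** * Bound on the failure probability *)

Section FailureProbability.
Variables (R : realType) (n d k : nat) (Q : 'M[R]_(n, d.+1)) (zeta eps : R).
Hypothesis QQ : Q^T *m Q = 1%:M.
Hypothesis zeta0 : 0 < zeta.
Hypothesis zetak : zeta <= k%:R.
Hypothesis eps01 : 0 < eps < 1.
Local Notation M := 'M[R]_d.+1.
Local Notation D := (d.+1%:R : R).
Local Notation J0 := d.+2.
Local Notation mu := (coherence Q).
Variables (th p q Gam : R).
Local Notation t := (th / k%:R).
Local Notation lam := (1 - t + th ^+ 2 * (k%:R ^- 2 + (zeta * k%:R)^-1 * mu / 2)).
Local Notation Kv := (th ^+ 2 / (k%:R * lam)).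
Local Notation c := (p / (7 / 10 * D)).
Hypothesis th0 : 0 < th.
Hypotheses (lam0 : 0 < lam) (lam1 : lam <= 1).
Hypotheses (p1 : 1 < p) (pq : p^-1 + q^-1 = 1).
Hypothesis GamP : forall v, 0 <= v <= D / 4 ->
  101 / 100 * c ^+ 2 * Kv * (7 / 10 * D + v) ^+ 2 + ln 2 * (7 / 10 * D + v) - 8 / 3 * v
    + D * ln (477 / 224) <= Gam.

Let k0 : 0 < k%:R :> R. Proof. exact: lt_le_trans zetak. Qed.
Let t0 : 0 < t. Proof. by rewrite divr_gt0. Qed.
Let p0 : 0 < p. Proof. exact: lt_trans p1. Qed.
Let D0 : 1 <= D. Proof. by rewrite ler1n. Qed.
Let c0 : 0 < c. Proof. by rewrite divr_gt0 // mulr_gt0 //; lra. Qed.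
Let Kv0 : 0 <= Kv. Proof. by rewrite divr_ge0 ?sqr_ge0 // mulr_ge0 // ltW. Qed.

(** [s ^+ 2] is inversely proportional to [N], so a large [N] meets both smallness conditions;
    [400 = 20 ^ 2] comes from comparing squares. *)
Lemma exists_resolution : exists N s, [/\ (0 < N)%N, 0 <= s, s ^+ 2 = t ^+ 2 / (lam * N%:R),
  `|q * s| <= 20^-1 & c * (s * (D ^+ 2 * J0%:R ^+ 2)) <= 20^-1].
Proof.
pose e := c * (D ^+ 2 * J0%:R ^+ 2).
have e0 : 0 <= e by rewrite mulr_ge0 ?(ltW c0) // mulr_ge0 ?sqr_ge0.
pose v := t ^+ 2 / lam; have v0 : 0 < v by rewrite divr_gt0 // exprn_gt0.
pose b := 400 * (v * (q ^+ 2 + e ^+ 2)).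
have b0 : 0 <= b by rewrite /b mulr_ge0 // mulr_ge0 ?(ltW v0) // addr_ge0 ?sqr_ge0.
have /andP[_ bN] := truncn_itv b0.
set N := (Num.truncn b).+1 in bN *.
have N0 : 0 < N%:R :> R by rewrite ltr0n.
exists N, (Num.sqrt (v / N%:R)).
set s := Num.sqrt _; have s0 : 0 <= s by exact: sqrtr_ge0.
have s2 : s ^+ 2 = v / N%:R by rewrite sqr_sqrtr // divr_ge0 ?ltW.
have small x : x ^+ 2 * (400 * v) <= b -> `|x * s| <= 20^-1.
  move=> xb; rewrite -ler_sqr ?nnegrE ?normr_ge0 ?invr_ge0 //.
  rewrite real_normK ?num_real // exprMn s2 mulrA ler_pdivrMr //.
  have -> : (20^-1 : R) ^+ 2 = 400^-1 by field.
  lra.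
split=> //.
- by rewrite s2 /v -[LHS]mulrA -(invfM lam).
- by apply: small; rewrite /b; have := mulr_ge0 (ltW v0) (sqr_ge0 e); lra.
have -> : c * (s * (D ^+ 2 * J0%:R ^+ 2)) = e * s by rewrite /e; ring.
apply: le_trans (ler_norm _) _; apply: small.
by rewrite /b; have := mulr_ge0 (ltW v0) (sqr_ge0 q); lra.
Qed.

Lemma psd_sum (I : finType) (F : I -> M) : (forall i, psd (F i)) -> psd (\sum_i F i).
Proof.
move=> pF; elim/big_rec: _ => [|i x _ px]; last exact: psdD.
by rewrite -(raddf0 (@scalar_mx R d.+1)); exact: psd_scalar.
Qed.

Definition failure : {pred outcome k n} :=
  [pred w | ~~ `[< subspace_injection (1 - eps) (sparse_embedding zeta w) Q >]].

(** Deterministic half of the Chernoff bound: a violating [u] has Rayleigh quotient above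
    [C - th * (1 - eps)], and [\tr (K ^+ j)] dominates the [j]-th power of that quotient. *)
Lemma failure_trexp (w : outcome k n) (C : R) J : w \in failure -> th <= C ->
  psd (C%:M + \sum_r row_step k Q zeta th (rows_of w r)) ->
  \sum_(j < J.+1) (C - th * (1 - eps)) ^+ j / j`!%:R <=
  trexp J (C%:M + \sum_r row_step k Q zeta th (rows_of w r)).
Proof.
rewrite inE => /asboolPn /existsNP[u /negP]; rewrite -ltNge => hu Cth pK.
set K := _ + _ in pK *; set C0 := C - _.
have C00 : 0 <= C0.
  have := mulr_gt0 th0 (andP eps01).1; rewrite /C0; lra.
have su : sqnorm u = qf 1 u by rewrite qf1.
have qK : C0 * qf 1 u < qf K u.
  rewrite qf_rows -su /C0 mulrBl ltrD2l ltrN2 -mulrA ltr_pM2l //.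
have u0 : 0 < qf 1 u.
  rewrite lt0r qf1_ge0 andbT; apply/eqP => z.
  have := psd_qf_le_tr u pK; rewrite z mul0r => h.
  by move: qK; rewrite z mulr0 ltNge h.
apply: ler_sum => j _; rewrite ler_wpM2r ?invr_ge0 //.
have := tr_powX_ge j u pK; rewrite -ler_pdivrMl ?exprn_gt0 // mulrC -expr_div_n.
have K0 : 0 <= qf K u by exact: pK.2.
apply: le_trans; rewrite lerXn2r ?nnegrE ?divr_ge0 ?(ltW u0) //.
by rewrite ler_pdivlMr // ltW.
Qed.

(* The large multiple [C] of the identity keeps every intermediate matrix
   positive semidefinite; [N] sign steps of size [s] have the same second-order
   effect as one sparse row.  The truncation error [err J] vanishes as [J] grows. *)
Lemma failure_bound : \sum_(w in failure) weight zeta w <=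
  D * expR (- (th * eps) + th ^+ 2 * (k%:R^-1 + mu / (2 * zeta))
    + p^-1 * Gam + q^-1 * (101 / 200 * (q ^+ 2 * Kv))).
Proof.
have [N [s [N0 s0 s2 qs small]]] := exists_resolution.
have NR0 : 0 < N%:R :> R by rewrite ltr0n.
have N1 : 1 <= N%:R :> R by rewrite ler1n.
pose z := rvec (entry k zeta) Q.
pose Bz := \sum_a qf 1 (z a).
have zB a : qf 1 (z a) <= Bz.
  by rewrite /Bz (bigD1 a) //= lerDl sumr_ge0 // => *; exact: qf1_ge0.
have Bz0 : 0 <= Bz by apply: sumr_ge0 => *; exact: qf1_ge0.
(* One unit of reserve: [s * D] pays for a sign step, [th * Bz] for a row step, and the last [th]
   guarantees [th <= C]. *)
pose beta := s * D + th * Bz + th.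
have thBz0 : 0 <= th * Bz by rewrite mulr_ge0 // ltW.
have sD0 : 0 <= s * D by rewrite mulr_ge0.
have sb : s * D <= beta by rewrite /beta -addrA lerDl addr_ge0 // ltW.
have beta0 : 0 <= beta by apply: le_trans sb.
have Nb : beta <= N%:R * beta by rewrite ler_peMl.
pose C := (k * N)%:R * beta.
have CE : C = k%:R * (N%:R * beta) by rewrite /C natrM mulrA.
have k1 : 1 <= k%:R :> R by move: k0; rewrite ltr0n ler1n.
have Cth : th <= C.
  apply: le_trans (_ : beta <= _); first by rewrite /beta lerDr addr_ge0.
  by apply: le_trans Nb _; rewrite CE ler_peMl // mulr_ge0.
have C0 : 0 <= C by apply: le_trans Cth; exact: ltW.
have xstep a : psd ((N%:R * beta)%:M + row_step k Q zeta th a).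
  apply: (@psd_scalar_le _ _ (th * qf 1 (z a))).
    apply: le_trans Nb; apply: le_trans (ler_wpM2l (ltW th0) (zB a)) _.
    by rewrite /beta addrAC lerDr addr_ge0 // ltW.
  by apply: psd_scalar_sub_outer => //; exact: ltW.
(* The first half keeps positivity for [m] more units; the second keeps [K] below [2 * C], which
   makes the truncation error uniform in [K]. *)
pose Dom m (K : M) := psd (K - (m%:R * beta)%:M) /\ psd ((2 * C - m%:R * beta)%:M - K).
have upper m r (K E : M) : psd ((2 * C - (r + m)%:R * beta)%:M - K) ->
    psd ((r%:R * beta)%:M - E) -> psd ((2 * C - m%:R * beta)%:M - (K + E)).
  move=> pK pE; have -> : (2 * C - m%:R * beta)%:M - (K + E) =
     ((2 * C - (r + m)%:R * beta)%:M - K) + ((r%:R * beta)%:M - E).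
    rewrite addrACA -raddfD /= -opprD; congr (_%:M - _).
    rewrite natrD; ring.
  exact: psdD.
pose f J := trexp J : M -> R.
pose TX := avg (row_weight k zeta (n := n)) (row_step k Q zeta th).
pose TY := avg (@sign_weight R d) (@sign_step R d s).
have DX m K a : Dom (N + m)%N K -> Dom m (K + row_step k Q zeta th a).
  case=> h1 h2; split; first exact: psd_sub_scalar_step h1 (xstep a).
  apply: upper h2 _; rewrite /row_step opprK.
  by apply: psdD; [apply: psd_scalar; rewrite mulr_ge0|apply: psd_outer; exact: ltW].
have DY m K b : Dom m.+1 K -> Dom m (K + sign_step s b).
  case=> h1 h2; split.
    apply: (psd_sub_scalar_step (r := 1)) h1 _; rewrite mul1r.
    by apply: psd_scalar_le sb _; exact: psd_sign_step_add.
  apply: (upper m 1%N) h2 _; rewrite mul1r.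
  apply: psd_scalar_le sb _.
  have := psd_sign_step_add s0 (~~ b.1, b.2); rewrite /sign_step /=.
  by case: (b.1); rewrite /= !scaleNr ?opprK.
pose err J := t * (D * ((2 * C) ^+ J / J`!%:R)).
have err0 J : 0 <= err J.
  by rewrite mulr_ge0 ?(ltW t0) // mulr_ge0 // divr_ge0 // exprn_ge0 // mulr_ge0.
have onestep J K : Dom N K -> TX (f J) K <= lam * iter N TY (f J) K + err J.
  case=> h1 h2.
  have pK : psd K by exact: (psd_weaken s0 sb h1).
  have px a : psd (K - th *: (z a *m (z a)^T)).
    have := psd_sub_scalar_step (m := 0) (r := N) (K := K) _ (xstep a).
    rewrite addn0 mul0r raddf0 subr0; exact.
  have kz0 : 0 <= (zeta * k%:R)^-1 by rewrite invr_ge0 mulr_ge0 // ltW.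
  have X1 := EE_trexp_upper (entry_weight_ge0 zeta0 zetak) (entry_weight1 zeta0 zetak)
    (entry_mean k zeta) (entry_var zeta0 zetak) (entry_third k zeta) (entry_fourth zeta0 zetak)
    QQ J pK kz0 (coherence_ge0 Q) (ltW th0) px (coherence_row Q).
  have Y1 := iter_sign_lower s0 sb J h1.
  have tK : \tr (K ^+ J) <= D * (2 * C) ^+ J.
    apply: tr_powX_le => //; first by rewrite mulr_ge0.
    have -> : (2 * C)%:M - K = (N%:R * beta)%:M + ((2 * C - N%:R * beta)%:M - K).
      by rewrite addrA -raddfD /= subrKC.
    by apply: psdD => //; apply: psd_scalar; rewrite mulr_ge0.
  have X2 : TX (f J) K <= lam * f J K + t ^+ 2 * convexp J K + t * (\tr (K ^+ J) / J`!%:R).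
    apply: le_trans X1 _; rewrite le_eqVlt; apply/orP; left; apply/eqP.
    rewrite -exprVn /f; ring.
  apply: le_trans X2 _; apply: lerD.
    (* Second-order matching: after [lam] is factored out, the coefficient of [convexp] is exactly
       what [N] sign steps provide. *)
    have -> : t ^+ 2 = lam * (N%:R * s ^+ 2).
      have cancel2 (x y w : R) : y != 0 -> w != 0 -> x = y * (w * (x / (y * w))).
        by move=> y0 w0; field; rewrite y0 w0.
      by rewrite s2; apply: cancel2; rewrite gt_eqF.
    by rewrite -(mulrA lam) -(mulrDr lam) ler_wpM2l ?(ltW lam0).
  by rewrite /err ler_wpM2l ?(ltW t0) // mulrA ler_wpM2r ?invr_ge0.
have DomC : Dom (k * N)%N C%:M.
  by split; rewrite -raddfB; apply: psd_scalar; rewrite -/C; lra.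
pose A := lam ^+ k * (D * expR (C + p^-1 * Gam + q^-1 * ((k * N)%:R * (101 / 200 * (q * s) ^+ 2)))).
have rw1 := @row_weight1 R n k zeta zeta0 zetak.
have rw0 := @row_weight_ge0 R n k zeta zeta0 zetak.
have kNs : (k * N)%:R * s ^+ 2 = Kv.
  have cancel3 (x y v w : R) : y != 0 -> v != 0 -> w != 0 ->
      y * w * ((x / y) ^+ 2 / (v * w)) = x ^+ 2 / (y * v).
    by move=> y0 v0 w0; field; rewrite y0 v0 w0.
  by rewrite s2 natrM; apply: cancel3; rewrite gt_eqF.
have bound J : iter k TX (f J) C%:M <= A + k%:R * err J.
  have cmp := iter_avg_compare rw0 rw1 (@sign_weight_ge0 R d) (@sign_weight1 R d) DX DY
     (introT andP (conj (ltW lam0) lam1)) (err0 J) (onestep J) DomC.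
  apply: le_trans cmp _; rewrite lerD2r /A ler_wpM2l ?exprn_ge0 ?(ltW lam0) //.
  apply: (@iter_trexp_le R d p (101 / 100 * c ^+ 2 * Kv) Gam (477 / 224)) => //.
  - by rewrite divr_gt0.
  - exact: sum_prior_le.
  - by rewrite mulr_ge0 // mulr_ge0 ?sqr_ge0 // divr_ge0.
  - by rewrite -kNs; ring.
  rewrite /C ler_wpM2l //.
have pw (w : outcome k n) : psd (C%:M + \sum_r row_step k Q zeta th (rows_of w r)).
  have -> : C%:M + \sum_r row_step k Q zeta th (rows_of w r) =
      \sum_(r < k) ((N%:R * beta)%:M + row_step k Q zeta th (rows_of w r)).
    by rewrite big_split /= sumr_const card_ord CE -raddfMn mulr_natl.
  by apply: psd_sum => r; exact: xstep.
set P := \sum_(w in failure) _.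
have P0 : 0 <= P by apply: sumr_ge0 => w _; exact: weight_ge0.
set C1 := C - th * (1 - eps).
have C10 : 0 <= C1 by have := mulr_gt0 th0 (andP eps01).1; rewrite /C1; lra.
have main : P * expR C1 <= A.
  apply: (@exp_coeff_limit_le R P C1 A (k%:R * (t * D)) (2 * C)) => // J.
  have := bound J; rewrite -(expect_rows k Q zeta th (f J)) => B1.
  apply: le_trans (_ : A + k%:R * err J <= _); last by rewrite /err; lra.
  apply: le_trans B1; rewrite /P mulr_suml [leRHS](bigID (mem failure)) /=.
  rewrite ler_wpDr //.
    apply: sumr_ge0 => w _; rewrite mulr_ge0 ?trexp_ge0 //; exact: weight_ge0.
  apply: ler_sum => w wf; rewrite ler_wpM2l; first by [].
    exact: weight_ge0.
  exact: failure_trexp.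
rewrite -(ler_pM2r (expR_gt0 C1)); apply: le_trans main _; rewrite /A.
rewrite [leLHS]mulrCA -[leRHS]mulrA ler_wpM2l // -expRD.
have lamk : lam ^+ k <= expR (k%:R * (lam - 1)).
  rewrite expRM_natl lerXn2r ?nnegrE ?expR_ge0 ?(ltW lam0) //.
  by have := expR_ge1Dx (lam - 1); rewrite addrC subrK.
apply: le_trans (ler_wpM2r (expR_ge0 _) lamk) _.
rewrite -expRD ler_expR exprMn le_eqVlt; apply/orP; left; apply/eqP.
rewrite [(k * N)%:R * _](_ : _ = 101 / 200 * (q ^+ 2 * Kv)); last by rewrite -kNs; ring.
have -> : k%:R * (lam - 1) = - th + th ^+ 2 * (k%:R^-1 + mu / (2 * zeta)).
  by field; rewrite !gt_eqF.
by rewrite /C1; ring.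
Qed.

End FailureProbability.

(** * Choice of parameters and numerical estimates *)

Section Numerics.
Variable R : realType.

Lemma pac_numeric (D m v a : R) : 1 <= D -> D <= m -> 0 <= v <= D / 4 -> 0 <= a <= 3 / 5 * m ->
  101 / 100 * (a / (7 / 10 * D) ^+ 2) * (7 / 10 * D + v) ^+ 2 + ln 2 * (7 / 10 * D + v)
    - 8 / 3 * v + D * ln (477 / 224) <= 15 / 8 * m.
Proof.
move=> D1 Dm v0 a0; have D0 : 0 < D by lra.
pose x := v / D; have vE : v = x * D by rewrite /x divfK ?gt_eqF.
have x0 : 0 <= x <= 4^-1.
  by case/andP: v0 => h1 h2; rewrite /x divr_ge0 ?(ltW D0) //= ler_pdivrMr // mulrC.
have -> : 101 / 100 * (a / (7 / 10 * D) ^+ 2) * (7 / 10 * D + v) ^+ 2 =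
    101 / 100 * a * (1 + 10 / 7 * x) ^+ 2.
  by rewrite vE; field; rewrite gt_eqF.
have l2 := ln2_le R.
have lp : ln (477 / 224) <= 87 / 125 + 29 / 448 :> R.
  have -> : (477 / 224 : R) = 2 * (1 + 29 / 448) by field.
  rewrite lnM ?posrE //; last by lra.
  have : ln (1 + 29 / 448) <= 29 / 448 :> R by apply: le_ln1Dx; lra.
  lra.
clear v0; move: (ln 2) l2 (ln _) lp => l l2 l' lp.
(* [17 / 10] is [7 / 10] plus the 1 from [477 / 224 = 2 * (1 + 29 / 448)]. *)
rewrite vE; set b := 87 / 125 * (17 / 10 + x) - 8 / 3 * x + 29 / 448.
have b0 : 0 <= b by rewrite /b; lra.
have h1 : l * (7 / 10 * D + x * D) - 8 / 3 * (x * D) + D * l' <= D * b.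
  have : 0 <= (87 / 125 - l) * (D * (7 / 10 + x)).
    by apply: mulr_ge0; [lra|apply: mulr_ge0; lra].
  have : 0 <= D * (87 / 125 + 29 / 448 - l') by apply: mulr_ge0; lra.
  rewrite /b; lra.
have h2 : D * b <= m * b by rewrite ler_wpM2r.
have h3 : 101 / 100 * a * (1 + 10 / 7 * x) ^+ 2 <= 303 / 500 * m * (1 + 10 / 7 * x) ^+ 2.
  by rewrite ler_wpM2r ?sqr_ge0 //; lra.
(* The left side is a convex quadratic in [x], below [15 / 8] at both ends of [[0, 1/4]]; the
   product [x * (4^-1 - x)] encodes the chord. *)
have h4 : 303 / 500 * (1 + 10 / 7 * x) ^+ 2 + b <= 15 / 8.
  have : 0 <= x * (4^-1 - x) by apply: mulr_ge0; lra.
  rewrite /b; lra.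
have : m * (303 / 500 * (1 + 10 / 7 * x) ^+ 2 + b) <= m * (15 / 8) by rewrite ler_wpM2l //; lra.
lra.
Qed.

End Numerics.

Section NumericChoices.
Variables (R : realType) (k mu zeta eps L m D : R).
Hypotheses (k0 : 0 < k) (mu0 : 0 <= mu) (zeta0 : 0 < zeta) (eps0 : 0 < eps) (eps1 : eps < 1).
Hypotheses (L0 : 0 < L) (D1 : 1 <= D) (Dm : D <= m) (Lm : 6 * L <= m).
Hypothesis hk : 16 * m <= k * eps ^+ 2.
Hypothesis hz : 32 * mu * L <= zeta * eps ^+ 2.
Local Notation th := (6 * L / eps).
Local Notation t := (th / k).
Local Notation lam := (1 - t + th ^+ 2 * (k ^- 2 + (zeta * k)^-1 * mu / 2)).
Local Notation Kv := (th ^+ 2 / (k * lam)).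
Local Notation p := (m / (2 * L)).
Local Notation q := (m / (m - 2 * L)).

Let m0 : 0 < m. Proof. by apply: lt_le_trans Lm; rewrite mulr_gt0. Qed.
Let e20 : 0 < eps ^+ 2. Proof. exact: exprn_gt0. Qed.
Let th0 : 0 < th. Proof. by rewrite divr_gt0 // mulr_gt0. Qed.

Lemma th_sqr_k : th ^+ 2 / k <= 9 / 4 * L ^+ 2 / m.
Proof.
have -> : th ^+ 2 / k = 36 * L ^+ 2 / (k * eps ^+ 2) by field; rewrite !gt_eqF.
rewrite ler_pdivrMr ?mulr_gt0 // [leRHS]mulrAC ler_pdivlMr //.
have := ler_wpM2l (sqr_ge0 L) hk; lra.
Qed.

Lemma th_sqr_k' : th ^+ 2 / k <= 3 / 8 * L.
Proof.
apply: le_trans th_sqr_k _; rewrite ler_pdivrMr //.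
have := ler_wpM2l (ltW L0) Lm; lra.
Qed.

Lemma th_sqr_zeta : th ^+ 2 * (mu / (2 * zeta)) <= 9 / 16 * L.
Proof.
have -> : th ^+ 2 * (mu / (2 * zeta)) = 18 * L ^+ 2 * mu / (zeta * eps ^+ 2).
  by field; rewrite !gt_eqF.
rewrite ler_pdivrMr ?mulr_gt0 //.
have := ler_wpM2l (ltW L0) hz; lra.
Qed.

Lemma t_le : t <= 16^-1.
Proof.
rewrite ler_pdivrMr // ler_pdivrMr //.
have : eps ^+ 2 <= eps by rewrite expr2 ler_piMr // ltW.
have : 96 * L <= k * eps ^+ 2 by apply: le_trans hk; move: Lm; lra.
move=> h1 h2; have := ler_wpM2l (ltW k0) h2; lra.
Qed.

Lemma lam_ge : 15 / 16 <= lam.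
Proof.
have h : 0 <= th ^+ 2 * (k ^- 2 + (zeta * k)^-1 * mu / 2).
  rewrite mulr_ge0 ?sqr_ge0 // addr_ge0 // ?invr_ge0 ?sqr_ge0 // divr_ge0 // mulr_ge0 //.
  by rewrite invr_ge0 mulr_ge0 // ltW.
have := t_le; lra.
Qed.

(** The drift [th >= 6 * L] outweighs the second-order terms, which are at most
    [(3 / 8 + 9 / 16) * L]. *)
Lemma lam_le1 : lam <= 1.
Proof.
have -> : lam = 1 + k^-1 * (th ^+ 2 / k + th ^+ 2 * (mu / (2 * zeta)) - th).
  by field; rewrite !gt_eqF.
have h1 := th_sqr_k'; have h2 := th_sqr_zeta.
have h3 : 6 * L <= th by rewrite ler_pdivlMr // ler_piMr ?ltW // mulr_gt0.
have : 0 <= k^-1 * (th - (th ^+ 2 / k + th ^+ 2 * (mu / (2 * zeta)))).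
  by rewrite mulr_ge0 ?invr_ge0 ?(ltW k0) //; move: L0; lra.
lra.
Qed.

Lemma lam_gt0 : 0 < lam. Proof. by apply: lt_le_trans lam_ge; rewrite divr_gt0. Qed.

Lemma Kv_le : Kv <= 16 / 15 * (th ^+ 2 / k).
Proof.
have -> : Kv = th ^+ 2 / k / lam by rewrite invfM mulrA.
have x0 : 0 <= th ^+ 2 / k by rewrite divr_ge0 ?sqr_ge0 // ltW.
rewrite ler_pdivrMr ?lam_gt0 //; have := ler_wpM2l x0 lam_ge.
move: (th ^+ 2 / k) lam => x l; lra.
Qed.

Lemma Kv_ge0 : 0 <= Kv.
Proof. by rewrite divr_ge0 ?sqr_ge0 // mulr_ge0 ?(ltW k0) // ltW ?lam_gt0. Qed.

Lemma p_gt1 : 1 < p.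
Proof. by rewrite ltr_pdivlMr ?mulr_gt0 //; move: L0 Lm; lra. Qed.

Lemma pq1 : p^-1 + q^-1 = 1.
Proof. by rewrite !invf_div; field; rewrite gt_eqF. Qed.

Lemma q_le : q <= 3 / 2.
Proof. by rewrite ler_pdivrMr; move: L0 Lm; lra. Qed.

Lemma q_gt0 : 0 < q.
Proof. by rewrite divr_gt0 //; move: L0 Lm; lra. Qed.

(** With [p] proportional to [m / L], the factors [L] cancel against [th ^+ 2 / k]: the quadratic
    PAC-Bayes term has the order of [m], like the entropy terms. *)
Lemma pKv_le : 0 <= p ^+ 2 * Kv <= 3 / 5 * m.
Proof.
rewrite mulr_ge0 ?sqr_ge0 ?Kv_ge0 //=.
apply: le_trans (ler_wpM2l (sqr_ge0 _) Kv_le) _.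
apply: le_trans (_ : p ^+ 2 * (16 / 15 * (9 / 4 * L ^+ 2 / m)) <= _).
  by rewrite ler_wpM2l ?sqr_ge0 // ler_wpM2l ?th_sqr_k // divr_ge0.
rewrite le_eqVlt; apply/orP; left; apply/eqP; field.
by rewrite !gt_eqF.
Qed.

Lemma gamma_le v : 0 <= v <= D / 4 ->
  101 / 100 * (p / (7 / 10 * D)) ^+ 2 * Kv * (7 / 10 * D + v) ^+ 2
   + ln 2 * (7 / 10 * D + v) - 8 / 3 * v + D * ln (477 / 224) <= 15 / 8 * m.
Proof.
move=> vD; have := pac_numeric D1 Dm vD pKv_le.
have -> : 101 / 100 * (p / (7 / 10 * D)) ^+ 2 * Kv = 101 / 100 * (p ^+ 2 * Kv / (7 / 10 * D) ^+ 2).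
  by rewrite expr_div_n; ring.
by [].
Qed.

(** In units of [L] the terms are at most [- 6 + (3 / 8 + 9 / 16) + 15 / 4 + 303 / 1000], slightly
    less than [- 1]. *)
Lemma exponent_le : - (th * eps) + th ^+ 2 * (k^-1 + mu / (2 * zeta))
    + p^-1 * (15 / 8 * m) + q^-1 * (101 / 200 * (q ^+ 2 * Kv)) <= - L.
Proof.
have -> : th * eps = 6 * L by rewrite divfK ?gt_eqF.
have -> : p^-1 * (15 / 8 * m) = 15 / 4 * L by field; rewrite !gt_eqF.
have -> : q^-1 * (101 / 200 * (q ^+ 2 * Kv)) = 101 / 200 * (q * Kv).
  by have := q_gt0; move: q Kv => x y x0; field; rewrite gt_eqF.
have h1 := th_sqr_k'; have h2 := th_sqr_zeta.
have h3 : q * Kv <= 3 / 2 * (16 / 15 * (3 / 8 * L)).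
  apply: ler_pM; [exact: ltW q_gt0 | exact: Kv_ge0 | exact: q_le |].
  by apply: le_trans Kv_le _; rewrite ler_wpM2l // divr_ge0.
rewrite mulrDr; move: L0; lra.
Qed.

End NumericChoices.

Theorem theorem6p3 (R : realType) (n d k : nat) (Q : 'M[R]_(n, d))
  (eps delta zeta : R) :
  Q^T *m Q = 1%:M ->
  0 < eps < 1 -> 0 < delta < 1 ->
  (d <= k)%N ->
  0 < zeta <= k%:R ->
  k%:R >= 16 * Num.max (d%:R) (6 * ln (2 * d%:R / delta)) / eps ^+ 2 ->
  zeta >= 32 * coherence Q * ln (2 * d%:R / delta) / eps ^+ 2 ->
  @Prob R k n zeta (fun w => subspace_injection (1 - eps) (@sparse_embedding R k n zeta w) Q)
    >= 1 - delta.
Proof.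
move=> QQ /andP[eps0 eps1] /andP[del0 del1] _ /andP[zeta0 zetak] hk hz.
have total := @weight1 R n k zeta zeta0 zetak.
(* In dimension 0 every outcome is an injection; otherwise the square matrices form a nontrivial
   ring. *)
case: d Q QQ hk hz => [|d] Q QQ hk hz.
  rewrite /Prob (eq_bigl xpredT) ?total; last first.
    move=> w; apply/asboolP => u; rewrite [sqnorm u]big_ord0 mulr0.
    by apply: sumr_ge0 => i _; exact: sqr_ge0.
  by rewrite gerBl ltW.
have e20 : 0 < eps ^+ 2 by exact: exprn_gt0.
set D : R := d.+1%:R in hk hz *.
have D1 : 1 <= D by rewrite ler1n.
set L := ln (2 * D / delta) in hk hz *.
have Dd : 1 < 2 * D / delta by rewrite ltr_pdivlMr // mul1r; lra.
have L0 : 0 < L by exact: ln_gt0.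
set m := Num.max D (6 * L) in hk *.
have Dm : D <= m by rewrite le_max lexx.
have Lm : 6 * L <= m by rewrite le_max lexx orbT.
have k0 : 0 < k%:R :> R by exact: lt_le_trans zetak.
have hk' : 16 * m <= k%:R * eps ^+ 2 by rewrite -ler_pdivrMr.
have hz' : 32 * coherence Q * L <= zeta * eps ^+ 2 by rewrite -ler_pdivrMr.
have mu0 := coherence_ge0 Q.
have eps01 : 0 < eps < 1 by rewrite eps0.
have th0 : 0 < 6 * L / eps by rewrite divr_gt0 // mulr_gt0.
have F := @failure_bound R n d k Q zeta eps QQ zeta0 zetak eps01 _ _ _ _ th0
  (lam_gt0 k0 mu0 zeta0 eps0 eps1 Lm hk')
  (lam_le1 k0 zeta0 eps0 eps1 L0 Lm hk' hz') (p_gt1 L0 Lm) (pq1 L0 Lm)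
  (fun v vD => gamma_le k0 mu0 zeta0 eps0 eps1 L0 D1 Dm Lm hk' vD).
have Ex := exponent_le k0 mu0 zeta0 eps0 eps1 L0 Lm hk' hz'.
have {}F : \sum_(w in failure (k := k) Q zeta eps) weight zeta w <= delta / 2.
  (* [D * expR (- L)] equals [delta / 2], by the 2 inside the logarithm. *)
  apply: (le_trans F); apply: (@le_trans _ _ (D * expR (- L))).
    by rewrite ler_wpM2l // ler_expR.
  rewrite expRN lnK ?posrE; last by lra.
  by rewrite invf_div mulrA ler_pdivrMr; lra.
move: total; rewrite (bigID (mem (failure (k := k) Q zeta eps))) /=.
rewrite /Prob.
have -> : \sum_(w | w \notin failure (k := k) Q zeta eps) weight zeta w =
   \sum_(w | `[< subspace_injection (1 - eps) (sparse_embedding (k := k) zeta w) Q >]) weight zeta w :> R.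
  by apply: eq_bigl => w; rewrite inE negbK.
lra.
Qed.
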